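(* Let $\lambda\vdash n$ and let $M^\lambda$ be the permutation module of $\mathfrak{S}_n$ spanned by tabloids of shape $\lambda$. There exists an $\mathcal{H}_n(0)$-module structure on the vector space $M^\lambda$, giving an $\mathcal{H}_n(0)$-module $\widehat{M^\lambda}$, such that $F^Q_{char}(\widehat{M^\lambda})=h_\lambda=F_{char}(M^\lambda)$.
   Context: A tabloid of shape $\lambda$ is an equivalence class of fillings of the Young diagram of $\lambda$ by $1,\dots,n$ (each once), two fillings being equivalent when each row contains the same set of letters; $M^\lambda$ is the complex vector space with basis these tabloids, with $\mathfrak{S}_n$ permuting letters. $h_\lambda$ is the complete homogeneous symmetric function. The 0-Hecke algebra $\mathcal{H}_n(0)$ is the complex algebra generated by $\overline{\pi}_1,\dots,\overline{\pi}_{n-1}$ subject to $\overline{\pi}_i^2=-\overline{\pi}_i$, $\overline{\pi}_i\overline{\pi}_j=\overline{\pi}_j\overline{\pi}_i$ for $|i-j|\ge2$, and $\overline{\pi}_i\overline{\pi}_{i+1}\overline{\pi}_i=\overline{\pi}_{i+1}\overline{\pi}_i\overline{\pi}_{i+1}$. For $I\subseteq[n-1]$, $C_I$ is the one-dimensional $\mathcal{H}_n(0)$-module on which $\overline{\pi}_i$ acts by $-1$ if $i\in I$ and by $0$ otherwise. For a finite-dimensional $\mathcal{H}_n(0)$-module $N$ whose composition factors (with multiplicity) are $C_{I_1},\dots,C_{I_m}$, $F^Q_{char}(N)=\sum_{j}F_{I_j}$, where $F_I=\sum x_{i_1}x_{i_2}\cdots x_{i_n}$ over all $1\le i_1\le\cdots\le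 i_n$ with $i_j<i_{j+1}$ whenever $j\in I$ (Gessel's fundamental quasisymmetric function). For a finite-dimensional $\mathfrak{S}_n$-module $M\cong\bigoplus_\mu c_\mu S^\mu$ (Specht modules), $F_{char}(M)=\sum_\mu c_\mu s_\mu$ is the Frobenius characteristic; symmetric functions are regarded as quasisymmetric functions. *)

(* Defs.v *)
From HB Require Import structures.
From mathcomp Require Import all_boot all_order all_algebra all_fingroup.
From mathcomp Require Import finmap multiset.
From mathcomp Require Import reals complex.
Set Implicit Arguments.
Unset Strict Implicit.
Unset Printing Implicit Defensive.
Import GRing.Theory.
Local Open Scope ring_scope.

(* Partitions are their lists of parts. *)
Definition is_part (n : nat) (la : seq nat) : bool :=
  [&& sorted geq la, 0%N \notin la & sumn la == n].

(* The cells of the Young diagram of la are numbered 0, 1, 2, ... row by row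
   (rows and columns count from 0). *)
Definition cell_row (la : seq nat) (c : nat) : nat := reshape_index la c.
Definition cell_col (la : seq nat) (c : nat) : nat := reshape_offset la c.

(** * Formal power series of symmetric and quasisymmetric functions *)

(* Formal power series over int in commuting variables x_0, x_1, x_2, ...
   (a shift of the usual x_1, x_2, ...): a monomial is the multiset of the
   indices of its variables, and a series is its coefficient function. *)
Definition fps := {mset nat}%mset -> int.

Definition fps_one : fps := fun m => (m == mset0)%:R.

(* The index set of the sum is the set of all divisors of the monomial m. *)
Definition fps_mul (f g : fps) : fps := fun m =>
  \sum_(a <- undup [seq seq_mset (mask (tval b) m)
                      | b <- enum {: (size m).-tuple bool}])
     f a * g (m `\` a)%mset.

(* The sum of x_{w_1} x_{w_2} ... x_{w_k} over all words w such that P w: the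
   coefficient at m counts the rearrangements of m satisfying P. *)
Definition word_sum (P : pred (seq nat)) : fps := fun m =>
  (count P (permutations (enum_mset m)))%:R.

Definition complete_sym (k : nat) : fps :=
  word_sum (fun w => (size w == k) && sorted leq w).

Definition complete_sym_part (la : seq nat) : fps :=
  \big[fps_mul/fps_one]_(k <- la) complete_sym k.

(* A filling of the diagram of mu is the word of its entries in cell order. *)
Definition semistandard (mu w : seq nat) : bool :=
  (size w == sumn mu) &&
  [forall c : 'I_(sumn mu), forall d : 'I_(sumn mu),
    ((cell_row mu c == cell_row mu d) && (cell_col mu c < cell_col mu d)%N
       ==> (nth 0 w c <= nth 0 w d)%N) &&
    ((cell_col mu c == cell_col mu d) && (cell_row mu c < cell_row mu d)%N
       ==> (nth 0 w c < nth 0 w d)%N)].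

Definition schur (mu : seq nat) : fps := word_sum (semistandard mu).

(* A subset of {1, ..., n-1} is a set of ordinals, (j : 'I_n.-1) standing for
   j + 1; as positions in a word also count from 0, the element j of I gives
   the condition w_j < w_(j+1). *)
Definition fundamental (n : nat) (I : {set 'I_n.-1}) : fps :=
  word_sum (fun w => [&& size w == n, sorted leq w &
              [forall j in I, (nth 0 w (j : nat) < nth 0 w j.+1)%N]]).

(** * 0-Hecke modules *)

Section Hecke.
Variables (F : fieldType) (V : vectType F) (n : nat).
Implicit Type p : 'I_n.-1 -> 'End(V).

(* An H_n(0)-module structure on V, H_n(0) being given by its presentation:
   p j is the action of the generator \bar\pi_(j+1). *)
Record hecke0_module p : Prop := Hecke0Module {
  hecke0_quad : forall i, (p i \o p i)%VF = - p i;
  hecke0_comm : forall i j : 'I_n.-1, (i.+1 < j)%N ->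
    (p i \o p j)%VF = (p j \o p i)%VF;
  hecke0_braid : forall i j : 'I_n.-1, j = i.+1 :> nat ->
    (p i \o p j \o p i)%VF = (p j \o p i \o p j)%VF
}.

Definition hecke0_stable p (U : {vspace V}) : Prop :=
  forall i, (p i @: U <= U)%VS.

(* W / U is isomorphic to C_I *)
Definition factor_is p (U W : {vspace V}) (I : {set 'I_n.-1}) : Prop :=
  [/\ (U <= W)%VS, \dim W = (\dim U).+1 &
      forall i v, v \in W -> p i v - (if i \in I then - v else 0) \in U].

(* F^Q_char (V, p) = f: a composition series 0 = N 0 < N 1 < ... < N m = V has
   factors C_{I_1}, ..., C_{I_m} with f = F_{I_1} + ... + F_{I_m}. By
   Jordan-Hoelder there is at most one such f. *)
Definition FQchar_is p (f : fps) : Prop :=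
  exists (Is : seq {set 'I_n.-1}) (N : nat -> {vspace V}),
    [/\ N 0%N = 0%VS, N (size Is) = fullv,
        forall j, (j <= size Is)%N -> hecke0_stable p (N j),
        forall j, (j < size Is)%N ->
          factor_is p (N j) (N j.+1) (nth set0 Is j) &
        forall m, f m = \sum_(I <- Is) fundamental I m].

End Hecke.

(** * Tabloids and Specht modules *)

Section Tabloids.
Variables (n : nat) (la : seq nat).

(* A filling of the diagram by the letters of 'I_n is a permutation T, with T c
   the letter in cell c. Products of permutations compose from left to right, so
   T * s is obtained from T by letting s permute the letters. *)
Definition row_letters (T : 'S_n) (r : nat) : {set 'I_n} :=
  [set T c | c : 'I_n & cell_row la c == r].

Definition row_equiv : rel 'S_n := fun T U =>
  [forall r : 'I_(size la), row_letters T r == row_letters U r].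

Definition is_tabloid (A : {set 'S_n}) : bool :=
  A \in equivalence_partition row_equiv [set: 'S_n].

Definition tabloid := {A : {set 'S_n} | is_tabloid A}.
HB.instance Definition _ := Finite.on tabloid.

Lemma is_tabloid_class (T : 'S_n) : is_tabloid [set U | row_equiv T U].
Proof.
apply/imsetP; exists T; first by rewrite inE.
by apply/setP=> U; rewrite !inE.
Qed.

Definition tabloid_of (T : 'S_n) : tabloid := Sub _ (is_tabloid_class T).

Lemma row_letters_act (T s : 'S_n) r :
  row_letters (T * s)%g r = s @: row_letters T r.
Proof.
by rewrite /row_letters -imset_comp; apply: eq_imset => c /=; rewrite permM.
Qed.

Lemma row_equiv_act (s T U : 'S_n) :
  row_equiv (T * s)%g (U * s)%g = row_equiv T U.
Proof.
apply: eq_forallb => r; rewrite !row_letters_act.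
by apply/eqP/eqP => [|-> //]; apply: imset_inj; apply: perm_inj.
Qed.

Lemma is_tabloid_act (s : 'S_n) (A : {set 'S_n}) :
  is_tabloid A -> is_tabloid [set (T * s)%g | T in A].
Proof.
case/imsetP=> T _ ->; apply/imsetP; exists (T * s)%g; first by rewrite inE.
apply/setP=> U; rewrite !inE; apply/imsetP/idP => [[W]|].
  by rewrite !inE => ? ->; rewrite row_equiv_act.
by move=> eqU; exists (U * s^-1)%g;
   rewrite ?mulgKV // !inE -(row_equiv_act s) mulgKV.
Qed.

Definition tabloid_act (s : 'S_n) (t : tabloid) : tabloid :=
  Sub _ (is_tabloid_act s (valP t)).

Lemma tabloid_act_of (s T : 'S_n) :
  tabloid_act s (tabloid_of T) = tabloid_of (T * s)%g.
Proof.
apply: val_inj; apply/setP=> U; rewrite inE; apply/imsetP/idP => [[W]|].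
  by rewrite inE => ? ->; rewrite row_equiv_act.
by move=> eqU; exists (U * s^-1)%g;
   rewrite ?mulgKV // inE -(row_equiv_act s) mulgKV.
Qed.

Variable F : fieldType.

(* The permutation module M^la *)
Definition tabloid_mod : vectType F := {ffun tabloid -> F^o}.

Definition tabloid_vec (t : tabloid) : tabloid_mod :=
  [ffun u => (u == t)%:R].

Definition tabloid_rho (s : 'S_n) : 'End(tabloid_mod) :=
  linfun (fun v : tabloid_mod =>
            \sum_t (v : {ffun tabloid -> F^o}) t
                     *: tabloid_vec (tabloid_act s t)).

(* [linfun] is meaningful on linear functions only. *)
Lemma tabloid_rho_vec (s : 'S_n) (t : tabloid) :
  tabloid_rho s (tabloid_vec t) = tabloid_vec (tabloid_act s t).
Proof.
pose f (v : tabloid_mod) : tabloid_mod :=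
  \sum_t (v : {ffun tabloid -> F^o}) t *: tabloid_vec (tabloid_act s t).
have lin_f : linear f.
  move=> a u v; rewrite /f scaler_sumr -big_split /=; apply: eq_bigr => i _.
  by rewrite !ffunE scalerDl scalerA.
pose F_ := GRing.isLinear.Build F tabloid_mod tabloid_mod *:%R f lin_f.
pose f' : {linear tabloid_mod -> tabloid_mod} := HB.pack f F_.
rewrite [LHS](lfunE f') /= /f (bigD1 t) //= ffunE eqxx scale1r big1 ?addr0 //.
by move=> u /negPf ne_ut; rewrite ffunE ne_ut scale0r.
Qed.

(* The column stabilizer of T: the permutations of the letters that keep each
   letter in its column of T. *)
Definition col_stab (T : 'S_n) : {set 'S_n} :=
  [set s : 'S_n | [forall c : 'I_n,
     cell_col la ((T^-1)%g (s (T c))) == cell_col la c]].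

Definition polytabloid (T : 'S_n) : tabloid_mod :=
  \sum_(s in col_stab T)
     (-1) ^+ odd_perm s *: tabloid_vec (tabloid_act s (tabloid_of T)).

Definition specht : {vspace tabloid_mod} :=
  <<[seq polytabloid T | T <- enum 'S_n]>>%VS.

End Tabloids.

(** * Frobenius characteristic *)

(* The submodule U1 of (V1, rho1) is isomorphic to the submodule U2 of
   (V2, rho2). *)
Definition submod_iso (F : fieldType) (n : nat) (V1 V2 : vectType F)
    (rho1 : 'S_n -> 'End(V1)) (U1 : {vspace V1})
    (rho2 : 'S_n -> 'End(V2)) (U2 : {vspace V2}) : Prop :=
  exists f : 'Hom(V1, V2),
    [/\ (f @: U1)%VS = U2, {in U1 &, injective f} &
        forall s, {in U1, forall v, f (rho1 s v) = rho2 s (f v)}].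

(* F_char (V, rho) = f: V is the direct sum of submodules isomorphic to the
   Specht modules of shapes mu_1, ..., mu_k (with repetitions), and
   f = s_{mu_1} + ... + s_{mu_k}. There is at most one such f in
   characteristic 0. *)
Definition Fchar_is (F : fieldType) (n : nat) (V : vectType F)
    (rho : 'S_n -> 'End(V)) (f : fps) : Prop :=
  exists (k : nat) (mu : 'I_k -> seq nat) (U : 'I_k -> {vspace V}),
    [/\ forall j, is_part n (mu j),
        (\sum_j U j)%VS = fullv, directv (\sum_j U j),
        forall j,
          submod_iso (@tabloid_rho n (mu j) F) (specht n (mu j) F) rho (U j) &
        forall m, f m = \sum_j schur (mu j) m].

(* Main.v *)
(* 0-Hecke action: \bar\pi_j sends a tabloid to the one with the letters j, j+1
   exchanged if j lies in an earlier row than j+1, to its opposite if j lies in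
   a later row, and to 0 if they share a row. Ordering the tabloids by
   sum_i i * row(i) gives a composition series whose factors are the C_Des(t),
   Des(t) being the set of j lying in a later row than j+1. The coefficient of
   a monomial m in the sum of the F_Des(t) counts the tabloids whose row word
   is weakly increasing on the blocks of equal letters of m; this is the number
   of matrices over nat with row sums la and column sums the exponents of m,
   that is, the coefficient of m in h_la.

   Symmetric group action: the number of such matrices is
   sum_mu K_(mu, la) K_(mu, m), by the commutation of adding and removing
   horizontal strips, which amounts to a reflection of intervals. Hence
   h_la = sum_mu K_(mu, la) s_mu and, for m squarefree,
   dim M^la = sum_mu K_(mu, la) f^mu. Each semistandard tableau of shape mu and
   content la defines a map S^mu -> M^la, and all these maps together are
   injective on the direct sum of the S^mu: antisymmetrizing over the columns of
   a shape nu kills S^mu for mu <> nu with sum of row indices at most that of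
   nu, reduces S^nu to a line, and leaves a unitriangular system. Since
   dim S^mu >= f^mu by the standard polytabloids, the images fill M^la. *)

From HB Require Import structures.
Require Import Defs.
From mathcomp Require Import all_boot all_order all_algebra all_fingroup.
From mathcomp Require Import zify.
From mathcomp Require Import finmap multiset.
From mathcomp Require Import reals complex.
Set Implicit Arguments.
Unset Strict Implicit.
Unset Printing Implicit Defensive.
Import GRing.Theory Num.Theory.

(** Two numbers stand in for the dominance order: [row_sum] separates shapes, and [weight], the sum
    of row index times entry, ranks the tableaux of one shape; triangularity arguments thus become
    minimality or maximality arguments over nat. Cells and letters are both numbered by ['I_n], so a
    tabloid [a] of shape la doubles as a filling of mu with content la: cell c receives [trow a c],
    the row of the letter c. In this reading the semistandard tableaux index the maps S^mu -> M^la
    and, for la = 1^n, the standard polytabloids. Monomials and contents are exponent lists whose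
    head belongs to the largest letter, so that removing the largest letter, the last strip of a
    chain or a column of a contingency table is one structural step on the list; as row 0 of a
    diagram is the smallest letter, partitions enter these lists reversed by [rev]. *)

Lemma sum_ord_recl (F : nat -> nat) n :
  \sum_(i < n.+1) F i = F 0 + \sum_(i < n) F i.+1.
Proof. by rewrite big_ord_recl. Qed.

Lemma sum_ord_recr (F : nat -> nat) n :
  \sum_(i < n.+1) F i = \sum_(i < n) F i + F n.
Proof. by rewrite big_ord_recr. Qed.

(** * Horizontal strips *)

Section Strips.
(* Partitions are padded with zeros to n + 1 parts; a partition of size at most
   n then has last part 0, which leaves room for one more horizontal strip. *)
Variable n : nat.
Local Notation bpart := {ffun 'I_n.+1 -> 'I_n.+1}.
Implicit Types (kap rho mu nu : bpart).

Definition pnth rho (i : nat) : nat :=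
  if insub i is Some j then rho j else 0.

Lemma pnth_ord rho (i : 'I_n.+1) : pnth rho i = rho i.
Proof. by rewrite /pnth valK. Qed.

Lemma pnth_out rho i : n < i -> pnth rho i = 0.
Proof. by move=> lt_ni; rewrite /pnth insubF // ltnS leqNgt lt_ni. Qed.

Lemma pnth_le rho i : pnth rho i <= n.
Proof. by rewrite /pnth; case: insub => // j; rewrite -ltnS. Qed.

Definition mkpart (f : nat -> nat) : bpart := [ffun i : 'I_n.+1 => inord (f i)].

Lemma pnth_mkpart f i : i <= n -> f i <= n -> pnth (mkpart f) i = f i.
Proof. by move=> le_in le_fn; rewrite /pnth insubT ffunE inordK. Qed.

Lemma eq_bpart rho mu : (forall i, i <= n -> pnth rho i = pnth mu i) -> rho = mu.
Proof.
move=> eq_rm; apply/ffunP=> i; apply: val_inj.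
by rewrite /= -!pnth_ord eq_rm // -ltnS.
Qed.

Definition psize rho := \sum_(i < n.+1) pnth rho i.

Definition strip kap rho :=
  [forall i : 'I_n.+1, (pnth kap i <= pnth rho i) && (pnth rho i.+1 <= pnth kap i)].

Lemma stripP kap rho :
  reflect (forall i, pnth kap i <= pnth rho i /\ pnth rho i.+1 <= pnth kap i)
          (strip kap rho).
Proof.
apply: (iffP forallP) => [H i|H i]; last by apply/andP; apply: H.
have [le_in|lt_ni] := leqP i n; last by rewrite !pnth_out // ltnW.
by have /andP := H (Ordinal (le_in : i < n.+1)).
Qed.

Lemma strip_size kap rho : strip kap rho -> psize kap <= psize rho.
Proof. by move=> /stripP H; apply: leq_sum => i _; case: (H i). Qed.

Lemma strip_decr kap rho : strip kap rho ->
  (forall i, pnth kap i.+1 <= pnth kap i) /\ (forall i, pnth rho i.+1 <= pnth rho i).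
Proof.
move=> /stripP H; split=> i; have [H1 H2] := H i; have [H3 H4] := H i.+1; lia.
Qed.

(** Otherwise all n + 1 rows would be positive and the size at least n + 1. *)
Lemma last_row0 rho :
  (forall i, pnth rho i.+1 <= pnth rho i) -> psize rho <= n -> pnth rho n = 0.
Proof.
move=> decr szr; apply/eqP; rewrite -leqn0 leqNgt; apply/negP => pos.
have ge1 i : i <= n -> 0 < pnth rho i.
  move=> le_in; rewrite -(subKn le_in); elim: (n - i) (leq_subr i n) => [|k IH] le_k.
    by rewrite subn0.
  apply: leq_trans (IH (ltnW le_k)) _.
  by have := decr (n - k.+1); rewrite subnSK.
have: \sum_(i < n.+1) 1 <= psize rho by apply: leq_sum => i _; rewrite ge1 // -ltnS.
by rewrite sum_nat_const card_ord muln1 leqNgt ltnS szr.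
Qed.

Section Local.
Variables (mu nu : bpart) (s : nat).
Hypotheses (le_sn : s <= n).

Let hi i := maxn (pnth mu i) (pnth nu i).
Let lo i := minn (pnth mu i) (pnth nu i).
Let refl_up kap := mkpart (fun i =>
  if i is j.+1 then hi i + lo j - pnth kap j
  else s - \sum_(j < n) (hi j.+1 + lo j - pnth kap j)).
Let refl_dn rho := mkpart (fun i =>
  if i < n then hi i.+1 + lo i - pnth rho i.+1 else 0).
Let up := [pred rho | [&& strip mu rho, strip nu rho & psize rho == s]].
(** The inequality is the trace of the condition hi 0 <= rho 0 on the row that the reflection does
    not see: by [dn_size], the size of kap plus s exceeds the sizes of mu and nu together by rho 0 -
    hi 0. *)
Let dn := [pred kap | [&& strip kap mu, strip kap nu
                       & psize mu + psize nu <= psize kap + s]].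

Let hilo i : hi i + lo i = pnth mu i + pnth nu i.
Proof. rewrite /hi /lo; lia. Qed.

Let sum_hilo : \sum_(j < n.+1) hi j + \sum_(j < n.+1) lo j = psize mu + psize nu.
Proof.
rewrite -!big_split /=; apply: eq_bigr => i _; exact: hilo.
Qed.

(** As mu and nu lie inside a partition of size at most n, their last rows vanish; then lo n = 0 and
    the reflection concerns only the indices below n. *)
Let up_facts rho : up rho ->
  [/\ pnth mu n = 0, pnth nu n = 0 & forall i, hi i <= pnth rho i /\ pnth rho i.+1 <= lo i].
Proof.
case/and3P=> h1 h2 /eqP sz.
have s1 := strip_size h1; have s2 := strip_size h2.
have [d1 _] := strip_decr h1; have [d2 _] := strip_decr h2.
split; [by apply: last_row0 => //; lia|by apply: last_row0 => //; lia|].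
move=> i; have [a b] := stripP _ _ h1 i; have [c d] := stripP _ _ h2 i.
rewrite /hi /lo; lia.
Qed.

Let dn_facts kap : dn kap ->
  [/\ pnth mu n = 0, pnth nu n = 0 & forall i, hi i.+1 <= pnth kap i /\ pnth kap i <= lo i].
Proof.
case/and3P=> h1 h2 sz.
have s1 := strip_size h1; have s2 := strip_size h2.
have [_ d1] := strip_decr h1; have [_ d2] := strip_decr h2.
split; [by apply: last_row0 => //; lia|by apply: last_row0 => //; lia|].
move=> i; have [a b] := stripP _ _ h1 i; have [c d] := stripP _ _ h2 i.
rewrite /hi /lo; lia.
Qed.

Let lo_le i : lo i <= n.
Proof. by have := pnth_le mu i; rewrite /lo; lia. Qed.

Let dnE rho : up rho -> forall i, i < n ->
  pnth (refl_dn rho) i = hi i.+1 + lo i - pnth rho i.+1.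
Proof.
move=> /up_facts [_ _ H] i lt_in.
have := H i.+1; have := H i; have := lo_le i => ? ? ?.
by rewrite pnth_mkpart ?lt_in //; lia.
Qed.

Let dn_last rho : pnth (refl_dn rho) n = 0.
Proof. by rewrite pnth_mkpart ?ltnn. Qed.

Let upE kap : dn kap -> forall i, i < n ->
  pnth (refl_up kap) i.+1 = hi i.+1 + lo i - pnth kap i.
Proof.
move=> /dn_facts [_ _ H] i lt_in.
have := H i.+1; have := H i; have := lo_le i => ? ? ?.
by rewrite pnth_mkpart //; lia.
Qed.

Let up_first kap :
  pnth (refl_up kap) 0 = s - \sum_(j < n) (hi j.+1 + lo j - pnth kap j).
Proof. by rewrite pnth_mkpart //; apply: leq_trans (leq_subr _ _) le_sn. Qed.

Let dn_size rho : up rho ->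
  psize (refl_dn rho) + s = psize mu + psize nu + (pnth rho 0 - hi 0).
Proof.
move=> upr; have [m0 n0 H] := up_facts upr.
case/and3P: (upr) => _ _ /eqP <-.
have lo0 : lo n = 0 by rewrite /lo m0 min0n.
have h0 : hi 0 <= pnth rho 0 by case: (H 0).
rewrite -sum_hilo /psize sum_ord_recr dn_last addn0.
rewrite (sum_ord_recl (pnth rho)) (sum_ord_recl hi) (sum_ord_recr lo) lo0 addn0.
have: \sum_(i < n) pnth (refl_dn rho) i + \sum_(i < n) pnth rho i.+1
      = \sum_(i < n) hi i.+1 + \sum_(i < n) lo i.
  rewrite -!big_split; apply: eq_bigr => i _.
  by rewrite /= dnE // subnK //; have := H i; have := H i.+1; lia.
lia.
Qed.

Let up_ok kap : dn kap -> up (refl_up kap) /\ refl_dn (refl_up kap) = kap.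
Proof.
move=> dnk; have [m0 n0 H] := dn_facts dnk.
have sum_eq : \sum_(j < n) (hi j.+1 + lo j - pnth kap j) + psize kap + hi 0
              = psize mu + psize nu.
  have lo0 : lo n = 0 by rewrite /lo m0 min0n.
  have kn0 : pnth kap n = 0 by have := H n; rewrite lo0; lia.
  rewrite -sum_hilo /psize (sum_ord_recr (pnth kap)) kn0 addn0.
  rewrite (sum_ord_recl hi) (sum_ord_recr lo) lo0 addn0.
  have: \sum_(j < n) (hi j.+1 + lo j - pnth kap j) + \sum_(i < n) pnth kap i
        = \sum_(i < n) hi i.+1 + \sum_(i < n) lo i.
    rewrite -!big_split; apply: eq_bigr => i _.
    by rewrite /= subnK //; have := H i; lia.
  lia.
have lesz : psize mu + psize nu <= psize kap + s by case/and3P: dnk.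
have nxt i : hi i.+1 <= pnth (refl_up kap) i.+1 /\ pnth (refl_up kap) i.+1 <= lo i.
  have [lt_in|le_ni] := ltnP i n; first by rewrite upE //; have := H i; lia.
  by rewrite /hi !pnth_out ?ltnS //; split.
have fst0 : hi 0 <= pnth (refl_up kap) 0 by rewrite up_first; lia.
split; last first.
  apply: eq_bpart => i; rewrite leq_eqVlt => /orP[/eqP ->|lt_in].
    rewrite dn_last; have := H n; rewrite /lo m0; lia.
  have [a b] := H i; have c := lo_le i.
  by rewrite pnth_mkpart ?(ltnW lt_in) // lt_in upE //; lia.
apply/and3P; split.
- apply/stripP => -[|i]; rewrite /hi /lo in nxt fst0; first by have := nxt 0; lia.
  by have := nxt i; have := nxt i.+1; lia.
- apply/stripP => -[|i]; rewrite /hi /lo in nxt fst0; first by have := nxt 0; lia.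
  by have := nxt i; have := nxt i.+1; lia.
- rewrite /psize sum_ord_recl up_first.
  have -> : \sum_(j < n) pnth (refl_up kap) j.+1
            = \sum_(j < n) (hi j.+1 + lo j - pnth kap j).
    by apply: eq_bigr => i _; rewrite upE.
  by rewrite subnK //; lia.
Qed.

Let dn_ok rho : up rho -> dn (refl_dn rho) /\ refl_up (refl_dn rho) = rho.
Proof.
move=> upr; have [m0 n0 H] := up_facts upr.
have lo0 : lo n = 0 by rewrite /lo m0 min0n.
have dsz := dn_size upr.
have le0 : hi 0 <= pnth rho 0 by case: (H 0).
have cst i : hi i.+1 <= pnth (refl_dn rho) i /\ pnth (refl_dn rho) i <= lo i.
  have [lt_in|le_ni] := ltnP i n.
    by rewrite dnE //; have := H i; have := H i.+1; lia.
  have [->|ne_in] := eqVneq i n.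
    by rewrite dn_last /hi !pnth_out.
  by rewrite /hi !pnth_out //; lia.
split.
  apply/and3P; split; last by lia.
  - by apply/stripP => i; have := cst i; rewrite /hi /lo; lia.
  - by apply/stripP => i; have := cst i; rewrite /hi /lo; lia.
apply: eq_bpart => -[|i] le_in; last first.
  by rewrite pnth_mkpart //= dnE //; have := H i; have := H i.+1; have := lo_le i; lia.
rewrite up_first (eq_bigr (fun j : 'I_n => pnth rho j.+1)) => [|j _].
  by case/and3P: upr => _ _ /eqP <-; rewrite /psize sum_ord_recl addnK.
by rewrite dnE //; have := H j; have := H j.+1; lia.
Qed.

(* [kap_i] and [rho_(i+1)] range over the same interval
   [max (mu_(i+1)) (nu_(i+1)), min mu_i nu_i]; reflecting it pairs the strips
   going up with those going down, and [rho_0] is fixed by the size. *)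
Lemma card_strips : #|up| = #|dn|.
Proof.
rewrite -!sum1_card (reindex_onto refl_up refl_dn) => [|rho /dn_ok[]//].
apply: eq_bigl => kap; apply/andP/idP => [[upk /eqP <-]|dnk].
  by have [] := dn_ok upk.
by have [? ->] := up_ok dnk.
Qed.

End Local.

Implicit Types f g : bpart -> nat.

Definition add_strip a f rho :=
  \sum_(kap | strip kap rho && (psize rho == psize kap + a)) f kap.
Definition del_strip a f kap :=
  \sum_(rho | strip kap rho && (psize rho == psize kap + a)) f rho.
Definition dot f g := \sum_rho f rho * g rho.

Lemma dotC f g : dot f g = dot g f.
Proof. by apply: eq_bigr => rho _; rewrite mulnC. Qed.

Lemma dot_add_strip a f g : dot (add_strip a f) g = dot f (del_strip a g).
Proof.
rewrite /dot /add_strip /del_strip.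
under eq_bigr => rho _ do rewrite big_distrl /=.
under [RHS]eq_bigr => rho _ do rewrite big_distrr /=.
by rewrite (exchange_big_dep predT).
Qed.

Lemma dot_bilin (A B : bpart -> pred bpart) f g :
  dot (fun rho => \sum_(mu | A mu rho) f mu) (fun rho => \sum_(nu | B nu rho) g nu)
  = \sum_mu \sum_nu f mu * g nu * #|[pred rho | A mu rho && B nu rho]|.
Proof.
transitivity (\sum_rho \sum_mu \sum_nu (A mu rho * f mu) * (B nu rho * g nu)).
  apply: eq_bigr => rho _.
  rewrite (big_mkcond (A^~ rho)) (big_mkcond (B^~ rho)) big_distrlr /=.
  apply: eq_bigr => mu _; apply: eq_bigr => nu _.
  by case: (A _ _) (B _ _) => [] []; rewrite ?mul1n ?mul0n.
rewrite exchange_big; apply: eq_bigr => mu _.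
rewrite exchange_big; apply: eq_bigr => nu _.
rewrite -sum1_card [in RHS]big_mkcond big_distrr /=; apply: eq_bigr => rho _.
rewrite inE; by case: (A _ _) (B _ _) => [] []; rewrite /= ?mul1n ?muln1 ?muln0.
Qed.

(** Both sides are bilinear in f and g, and for each pair mu, nu the identity is [card_strips]. The
    index j is the slack in the inequality of the lower set there; the support condition keeps mu
    with a new strip within size n. *)
Lemma dot_add_add a b f g :
  (forall mu, f mu != 0 -> psize mu + a <= n) ->
  dot (add_strip a f) (add_strip b g)
  = \sum_(j < b.+1 | j <= a) dot (del_strip (b - j) f) (del_strip (a - j) g).
Proof.
move=> supp_f.
rewrite (dot_bilin (fun mu rho => strip mu rho && (psize rho == psize mu + a))
                   (fun nu rho => strip nu rho && (psize rho == psize nu + b))).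
rewrite (eq_bigr _ (fun (j : 'I_b.+1) _ => dot_bilin
  (fun mu kap => strip kap mu && (psize mu == psize kap + (b - j)))
  (fun nu kap => strip kap nu && (psize nu == psize kap + (a - j))) f g)).
rewrite [RHS]exchange_big; apply: eq_bigr => mu _.
rewrite [RHS]exchange_big; apply: eq_bigr => nu _.
rewrite -big_distrr /=.
have [->|/supp_f le_mun] := eqVneq (f mu) 0; first by [].
congr (_ * _).
have [eq_s|ne_s] := eqVneq (psize mu + a) (psize nu + b); last first.
  rewrite big1 => [|j le_ja]; apply: eq_card0 => rho; rewrite !inE; apply/negP.
    by case/andP=> /andP[_ /eqP] ? /andP[_ /eqP] ?; lia.
  by case/andP=> /andP[_ /eqP] ? /andP[_ /eqP] ?; have := ltn_ord j; lia.
transitivity #|[pred rho | [&& strip mu rho, strip nu rho & psize rho == psize mu + a]]|.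
  apply: eq_card => rho; rewrite !inE -eq_s.
  by case: (strip mu _) (strip nu _) => [] []; rewrite //= ?andbF ?andbb.
rewrite card_strips //.
under [RHS]eq_bigr => j _ do rewrite -sum1_card big_mkcond.
rewrite exchange_big -sum1_card big_mkcond; apply: eq_bigr => kap _ /=.
rewrite !inE; case: ifP => [/and3P[s1 s2 le_s]|].
  have := strip_size s1; have := strip_size s2 => ? ?.
  (* The one j that counts kap: the size of nu must be that of kap plus a - j. *)
  have lt_j : psize kap + a - psize nu < b.+1 by lia.
  rewrite (bigD1 (Ordinal lt_j)) /=; last by lia.
  rewrite !inE s1 s2 /= ifT ?big1 //; last by apply/andP; split; apply/eqP; lia.
  move=> j /andP[le_ja ne_j]; rewrite !inE ifF //; apply/negP.
  case/andP=> /andP[_ /eqP ?] /andP[_ /eqP ?]; case/negP: ne_j.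
  by apply/eqP/val_inj => /=; lia.
move=> /negP ndn; rewrite big1 // => j le_ja; rewrite !inE ifF //; apply/negP.
case/andP=> /andP[s1 /eqP e1] /andP[s2 /eqP e2]; apply: ndn.
by rewrite s1 s2 /=; have := ltn_ord j; lia.
Qed.

Definition empty_part rho : nat := psize rho == 0.

(* [nchain al rho] counts the chains of horizontal strips from the empty
   partition to [rho]; the head of [al] is the size of the last strip. *)
Definition nchain (al : seq nat) : bpart -> nat := foldr add_strip empty_part al.

Lemma nchain_supp al rho : nchain al rho != 0 -> psize rho = sumn al.
Proof.
elim: al rho => [|a al IH] rho /=; first by rewrite /empty_part eqb0 negbK => /eqP.
rewrite -lt0n lt0n sum_nat_eq0 => /forallPn[kap].
by rewrite negb_imply => /andP[/andP[_ /eqP ->]] /IH ->; rewrite addnC.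
Qed.

End Strips.

(** * Contingency tables and the Robinson-Schensted-Knuth identity *)

Fixpoint subvecs (al : seq nat) : seq (seq nat) :=
  if al is a :: al' then [seq j :: ga | j <- iota 0 a.+1, ga <- subvecs al']
  else [:: [::]].

Fixpoint subvec (al ga : seq nat) : seq nat :=
  match al, ga with
  | a :: al', g :: ga' => (a - g) :: subvec al' ga'
  | _, _ => [::]
  end.

(** Multiplication by h_k on coefficient functions of exponent lists: [ga] is the row taken out of a
    table, [subvec al ga] the column sums left over. *)
Definition peel k (g : seq nat -> nat) (al : seq nat) : nat :=
  \sum_(ga <- subvecs al | sumn ga == k) g (subvec al ga).

(* The number of matrices over nat with row sums [la] and column sums [al]. *)
Definition ntable (la : seq nat) : seq nat -> nat :=
  foldr peel (fun al => nat_of_bool (sumn al == 0)) la.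

Lemma peel_cons k g a al :
  peel k g (a :: al)
  = \sum_(j < a.+1 | j <= k) peel (k - j) (fun be => g (a - j :: be)) al.
Proof.
rewrite /peel [LHS]big_mkcond.
rewrite -[subvecs (a :: al)]/[seq j :: ga | j <- iota 0 a.+1, ga <- subvecs al].
rewrite big_allpairs_dep.
rewrite -(big_mkord (fun j => j <= k) (fun j =>
  \sum_(ga <- subvecs al | sumn ga == k - j) g (a - j :: subvec al ga))).
rewrite /index_iota subn0 [RHS]big_mkcond; apply: eq_big_seq => j.
rewrite mem_iota => /andP[_ lt_j]; case: leqP => le_jk.
  by rewrite [RHS]big_mkcond; apply: eq_bigr => ga _ /=; congr (if _ then _ else _); lia.
by rewrite big1 // => ga _; rewrite /= ifF //; lia.
Qed.

Lemma peel_nil k g : peel k g [::] = (k == 0) * g [::].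
Proof. by rewrite /peel /= big_cons big_nil eq_sym; case: eqP; rewrite ?mul1n ?addn0. Qed.

Lemma eq_peel k g g' al : g =1 g' -> peel k g al = peel k g' al.
Proof. by move=> eg; apply: eq_bigr => ga _. Qed.

Lemma peel_sum k (I : finType) (P : pred I) (G : I -> seq nat -> nat) al :
  peel k (fun be => \sum_(i | P i) G i be) al = \sum_(i | P i) peel k (G i) al.
Proof. by rewrite /peel exchange_big. Qed.

(** Expanded along the first column, both sides become a double sum over the entries i, j of the two
    rows in that column, symmetric up to the induction hypothesis. *)
Lemma peelC k l g al : peel k (peel l g) al = peel l (peel k g) al.
Proof.
elim: al k l g => [|a al IH] k l g.
  by rewrite !peel_nil mulnCA.
have expand k' l' : peel k' (peel l' g) (a :: al) =
   \sum_(i < a.+1) \sum_(j < a.+1 | [&& i + j <= a, i <= k' & j <= l'])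
      peel (k' - i) (peel (l' - j) (fun be => g (a - i - j :: be))) al.
  rewrite peel_cons [LHS]big_mkcond /=; apply: eq_bigr => i _.
  have lt_i := ltn_ord i.
  case: leqP => le_ik; last by rewrite big1 // => j /and3P[]; lia.
  under eq_peel => be do rewrite peel_cons.
  rewrite peel_sum (big_ord_widen_cond a.+1 (fun j => j <= l') (fun j =>
    peel (k' - i) (peel (l' - j) (fun be => g (a - i - j :: be))) al)); last by lia.
  apply: eq_bigl => j /=; lia.
rewrite !expand (exchange_big_dep predT) //=; apply: eq_bigr => i _.
apply: eq_big => [j|j _]; last by rewrite IH subnAC.
by rewrite addnC [(j <= k) && _]andbC.
Qed.

Lemma ntable_rev la al : ntable (rev la) al = ntable la al.
Proof.
have rc l k be : ntable (rcons l k) be = ntable (k :: l) be.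
  elim: l be => [|b l IH] be //=.
  by rewrite peelC; apply: eq_peel => ga; exact: IH.
elim: la al => [|k la IH] al; first by [].
by rewrite rev_cons rc /=; apply: eq_peel.
Qed.

Section RSK.
Variable n : nat.
Local Notation bpart := {ffun 'I_n.+1 -> 'I_n.+1}.
Implicit Types (f : bpart -> nat).

Let part0 : bpart := mkpart n (fun _ => 0).

Let psize_eq0 rho : (psize rho == 0) = (rho == part0).
Proof.
apply/idP/eqP => [|->].
  rewrite sum_nat_eq0 => /forallP r0; apply: eq_bpart => i le_in.
  by rewrite pnth_mkpart //; apply/eqP; exact: (r0 (Ordinal (le_in : i < n.+1))).
by rewrite sum_nat_eq0; apply/forallP => i; rewrite pnth_mkpart // -ltnS.
Qed.

Let dot_empty f : dot (@empty_part n) f = f part0.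
Proof.
rewrite /dot (bigD1 part0) //= big1 => [|rho ne_r].
  by rewrite /empty_part psize_eq0 eqxx mul1n addn0.
by rewrite /empty_part psize_eq0 (negPf ne_r).
Qed.

Let add_strip_part0 a f : add_strip a f part0 = (a == 0) * f part0.
Proof.
have sz0 : psize part0 = 0 by apply/eqP; rewrite psize_eq0.
rewrite /add_strip sz0; case: a => [|a]; last by rewrite big1 // => kap /andP[_]; rewrite addnS.
rewrite mul1n (big_pred1 part0) // => kap; rewrite addn0 eq_sym psize_eq0 -[RHS]/(kap == part0).
have [->|_] := eqVneq kap part0; last by rewrite andbF.
by rewrite andbT; apply/stripP => i; split=> //; rewrite /pnth; case: insub => // j;
  rewrite ffunE inordK.
Qed.

(** The new strip is moved down the chain one step at a time. Passing a strip of size b by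
    [dot_add_add] splits off j, the table entry in the column of sum b; a - j is left for the other
    columns and b - j for the other rows. *)
Lemma dot_add_nchain a f al :
  (forall mu, f mu != 0 -> psize mu + a <= n) ->
  dot (add_strip a f) (@nchain n al) = peel a (fun be => dot f (nchain be)) al.
Proof.
elim: al a f => [|b al IH] a f supp_f.
  by rewrite peel_nil /= dotC dot_empty add_strip_part0 dotC dot_empty.
rewrite /= dot_add_add // peel_cons; apply: eq_bigr => j le_ja.
rewrite -dot_add_strip IH => [|kap].
  by apply: eq_peel => be /=; rewrite dotC -dot_add_strip dotC.
rewrite -lt0n lt0n sum_nat_eq0 => /forallPn[mu].
by rewrite negb_imply => /andP[/andP[_ /eqP sz_mu]] /supp_f; lia.
Qed.

Theorem ntable_nchain la al : sumn la <= n ->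
  ntable la al = dot (@nchain n la) (@nchain n al).
Proof.
elim: la al => [|k la IH] al /= le_n.
  rewrite dot_empty; elim: al => [|a al IHal] /=.
    by rewrite /empty_part psize_eq0 eqxx.
  by rewrite add_strip_part0 -IHal addn_eq0 mulnb.
rewrite dot_add_nchain => [|mu /nchain_supp ->]; last by lia.
by apply: eq_peel => be; apply: IH; lia.
Qed.

(** The recursion of [ntable] treats rows and columns differently, but the pairing of chains is
    symmetric. *)
Lemma ntable_sym la al : sumn la <= n -> sumn al <= n -> ntable la al = ntable al la.
Proof. by move=> le_la le_al; rewrite !ntable_nchain // dotC. Qed.

End RSK.

(** Counting by unique decomposition of words: [k] is the datum split off (the content of the first
    block, or the shape left by the largest letter), [x] the remaining word. *)
Lemma count_decomp (K W V : eqType) (P : pred V) (s : seq V) (ks : seq K)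
    (t : K -> seq W) (g : K -> W -> V) :
  uniq s -> uniq ks -> (forall k, uniq (t k)) ->
  (forall k x k' x', k \in ks -> x \in t k -> k' \in ks -> x' \in t k' ->
     g k x = g k' x' -> k = k' /\ x = x') ->
  (forall k x, k \in ks -> x \in t k -> g k x \in s /\ P (g k x)) ->
  (forall w, w \in s -> P w -> exists k x, [/\ k \in ks, x \in t k & w = g k x]) ->
  count P s = \sum_(k <- ks) size (t k).
Proof.
move=> Us Uks Ut inj_g in_s from_s; rewrite -size_filter.
rewrite (@perm_size _ _ [seq g k x | k <- ks, x <- t k]) ?size_allpairs_dep ?sumnE ?big_map //.
apply: uniq_perm; first exact: filter_uniq.
  apply: allpairs_uniq_dep => // -[k x] [k' x'].
  case/allpairsPdep=> k1 [x1 [k1s x1t [ek ex]]]; subst k1 x1.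
  case/allpairsPdep=> k1 [x1 [k1s' x1t' [ek ex]]]; subst k1 x1.
  by move=> /= /(inj_g _ _ _ _ k1s x1t k1s' x1t') [-> ->].
move=> w; rewrite mem_filter; apply/andP/allpairsPdep => [[Pw ws]|[k [x [ks_k tx ->]]]].
  exact: from_s.
by have [] := in_s _ _ ks_k tx.
Qed.

(* The sorted word of content [al], where the head of [al] is the multiplicity
   of the largest letter. *)
Fixpoint cword (al : seq nat) : seq nat :=
  if al is a :: al' then cword al' ++ nseq a (size al') else [::].

Fixpoint content N (w : seq nat) : seq nat :=
  if N is M.+1 then count_mem M w :: content M w else [::].

Lemma size_content N w : size (content N w) = N.
Proof. by elim: N => //= N ->. Qed.

Lemma size_cword al : size (cword al) = sumn al.
Proof. by elim: al => //= a al IH; rewrite size_cat size_nseq IH addnC. Qed.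

Lemma cword_lt al : all (fun x => x < size al) (cword al).
Proof.
elim: al => //= a al IH; rewrite all_cat all_nseq ltnSn orbT andbT.
by apply: sub_all IH => x /ltnW.
Qed.

Lemma sorted_cword al : sorted leq (cword al).
Proof.
elim: al => //= a al IH; rewrite (sorted_pairwise leq_trans) pairwise_cat.
rewrite -(sorted_pairwise leq_trans) IH -(sorted_pairwise leq_trans).
rewrite andbC; apply/andP; split; first by elim: a => //= -[|a] //= ->; rewrite leqnn.
apply/allrelP => x y /(allP (cword_lt al)) lt_x; rewrite mem_nseq => /andP[_ /eqP ->].
exact: ltnW.
Qed.

Lemma eq_content N w w' :
  (forall j, j < N -> count_mem j w = count_mem j w') -> content N w = content N w'.
Proof.
by elim: N => //= N IH eqc; rewrite eqc // IH // => j lt_j; apply/eqc/ltnW.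
Qed.

Lemma perm_content N w w' : perm_eq w w' -> content N w = content N w'.
Proof. by move=> /seq.permP eqw; apply: eq_content => j _; apply: eqw. Qed.

Lemma content_cword al : content (size al) (cword al) = al.
Proof.
elim: al => //= a al IH; rewrite count_cat count_nseq /= eqxx mul1n.
have -> : count_mem (size al) (cword al) = 0.
  apply/eqP; rewrite -leqn0 leqNgt -has_count; apply/hasPn => x /(allP (cword_lt al)).
  by rewrite /= => /ltn_eqF ->.
congr cons; rewrite -[RHS]IH; apply: eq_content => j lt_j.
by rewrite count_cat count_nseq /= (gtn_eqF lt_j) addn0.
Qed.

Lemma count_cword_content N w j :
  count_mem j (cword (content N w)) = if j < N then count_mem j w else 0.
Proof.
elim: N => //= N IH; rewrite count_cat count_nseq /= size_content IH ltnS.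
by rewrite [N == j]eq_sym; case: ltngtP => [_|_|->]; rewrite ?mul1n ?addn0.
Qed.

Lemma perm_cword_content N w : all (fun x => x < N) w -> perm_eq w (cword (content N w)).
Proof.
move=> ltw; apply/allP => x _; apply/eqP; rewrite /= count_cword_content.
case: ltnP => // le_Nx; apply/eqP; rewrite -leqn0 leqNgt -has_count.
by apply/hasPn => y /(allP ltw) /= lt_y; rewrite neq_ltn (leq_trans lt_y).
Qed.

Lemma cword_inj al be : size al = size be -> perm_eq (cword al) (cword be) -> al = be.
Proof.
by move=> eq_sz /(perm_content (size al)); rewrite content_cword eq_sz content_cword.
Qed.

Lemma mem_subvecs al ga : (ga \in subvecs al) = all2 leq ga al.
Proof.
elim: al ga => [|a al IH] [|g ga] //.
  by apply/negbTE/allpairsP => -[[? ?] []].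
rewrite -[subvecs (a :: al)]/[seq j :: ga | j <- iota 0 a.+1, ga <- subvecs al].
rewrite -[all2 _ _ _]/((g <= a) && all2 leq ga al) -IH.
apply/allpairsP/andP => [[[j be] [jin bein [-> ->]]]|[lega gain]].
  by split=> //; move: jin; rewrite mem_iota add0n ltnS.
by exists (g, ga); split; rewrite // mem_iota add0n ltnS.
Qed.

Lemma uniq_subvecs al : uniq (subvecs al).
Proof.
elim: al => [|a al IH] //.
rewrite -[subvecs (a :: al)]/[seq j :: ga | j <- iota 0 a.+1, ga <- subvecs al].
by apply: allpairs_uniq; rewrite ?iota_uniq // => -[? ?] [? ?] _ _ /= [-> ->].
Qed.

Lemma size_subvecs al ga : ga \in subvecs al -> size ga = size al.
Proof. by rewrite mem_subvecs all2E => /andP[/eqP]. Qed.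

Lemma size_subvec al ga : size ga = size al -> size (subvec al ga) = size al.
Proof. by elim: al ga => [|a al IH] [|g ga] //= [/IH ->]. Qed.

Lemma sumn_subvec al ga : ga \in subvecs al -> sumn ga + sumn (subvec al ga) = sumn al.
Proof.
rewrite mem_subvecs; elim: al ga => [|a al IH] [|g ga] //= /andP[lega /IH]; lia.
Qed.

Lemma count_cword_subvec al ga j : ga \in subvecs al ->
  count_mem j (cword ga) + count_mem j (cword (subvec al ga)) = count_mem j (cword al).
Proof.
rewrite mem_subvecs; elim: al ga => [|a al IH] [|g ga] //= /andP[lega gain].
rewrite !count_cat !count_nseq /=.
have sz : size ga = size al by apply: size_subvecs; rewrite mem_subvecs.
rewrite size_subvec // sz -(IH _ gain); by rewrite addnACA -mulnDr subnKC.
Qed.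

Lemma perm_cword_subvec al ga : ga \in subvecs al ->
  perm_eq (cword al) (cword ga ++ cword (subvec al ga)).
Proof.
move=> gain; apply/allP => x _; apply/eqP.
by rewrite /= count_cat count_cword_subvec.
Qed.

Lemma content_subvecs al w :
  (forall j, count_mem j w <= count_mem j (cword al)) ->
  content (size al) w \in subvecs al /\ perm_eq w (cword (content (size al) w)).
Proof.
move=> lew; split.
  rewrite mem_subvecs -[X in all2 _ _ X]content_cword.
  by elim: (size al) => //= N ->; rewrite lew.
apply: perm_cword_content; apply/allP => x xw; apply: (allP (cword_lt al)).
by rewrite -has_pred1 has_count (leq_trans _ (lew x)) // -has_count has_pred1.
Qed.

Definition blocks_sorted (be w : seq nat) := all (sorted leq) (reshape be w).

(** A sorted first block is determined by its content [ga], the first row of the table; the rest of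
    the word has content [subvec al ga]. *)
Lemma count_blocks_sorted be al : sumn be = sumn al ->
  count (blocks_sorted be) (permutations (cword al)) = ntable be al.
Proof.
elim: be al => [|b be IH] al /= eq_sum.
  have := size_cword al; rewrite -eq_sum => /size0nil ->.
  by rewrite /permutations /=.
pose ks := [seq ga <- subvecs al | sumn ga == b].
pose t ga := [seq v <- permutations (cword (subvec al ga)) | blocks_sorted be v].
rewrite (@count_decomp _ _ _ _ _ ks t (fun ga v => cword ga ++ v)).
- rewrite /peel big_filter big_seq_cond [RHS]big_seq_cond.
  apply: eq_bigr => ga /andP[gain /eqP sg]; rewrite size_filter IH //.
  by have := sumn_subvec gain; rewrite sg -eq_sum => /addnI.
- exact: permutations_uniq.
- exact: filter_uniq (uniq_subvecs al).
- by move=> ga; rewrite filter_uniq ?permutations_uniq.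
- move=> ga v ga' v'; rewrite !mem_filter => /andP[/eqP sg gain] _ /andP[/eqP sg' gain'] _.
  move=> /eqP; rewrite eqseq_cat ?size_cword ?sg ?sg' // => /andP[/eqP eqg /eqP ->].
  by split=> //; apply: cword_inj; rewrite ?eqg // (size_subvecs gain) (size_subvecs gain').
- move=> ga v; rewrite !mem_filter !mem_permutations => /andP[/eqP sg gain] /andP[bv pv].
  rewrite (seq.permPr (perm_cword_subvec gain)) perm_cat2l pv; split=> //.
  rewrite /blocks_sorted /= -sg -size_cword take_size_cat // drop_size_cat //.
  by rewrite sorted_cword.
move=> w; rewrite mem_permutations /blocks_sorted /= => pw /andP[so bl].
have [] := @content_subvecs al (take b w).
  by move=> j; rewrite -(seq.permP pw) -[X in _ <= _ X](cat_take_drop b w) count_cat leq_addr.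
set ga := content _ _ => gain pga.
have ega : take b w = cword ga.
  by apply: (sorted_eq leq_trans anti_leq); rewrite ?sorted_cword.
have sz_w : size w = sumn al by rewrite (perm_size pw) size_cword.
exists ga, (drop b w); split; last by rewrite -ega cat_take_drop.
- rewrite mem_filter gain andbT -size_cword -(perm_size pga) size_takel // sz_w -eq_sum.
  exact: leq_addr.
- rewrite mem_filter mem_permutations; apply/andP; split=> //.
  rewrite -(perm_cat2l (cword ga)) -(seq.permPr (perm_cword_subvec gain)) -ega.
  by rewrite cat_take_drop.
Qed.

(** * Semistandard tableaux as chains of horizontal strips *)

Definition frow (mu w : seq nat) r : seq nat := nth [::] (reshape mu w) r.

(** The shapes may differ by trailing zeros, as a padded partition and its trimmed form do. *)
Lemma eq_frow mu mu' w r : nth 0 mu =1 nth 0 mu' -> frow mu w r = frow mu' w r.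
Proof.
move=> eqn; rewrite /frow !nth_reshape eqn; congr (take _ (drop _ _)).
elim: r mu mu' eqn => [|r IH] mu mu' eqn; first by rewrite !take0.
have {}IH := IH (behead mu) (behead mu').
have := eqn 0; case: mu mu' eqn IH => [|x mu] [|y mu'] //= eqn IH.
- by move=> <-; rewrite -IH ?add0n // => i; have := eqn i.+1; rewrite !nth_nil.
- by move=> ->; rewrite IH ?add0n // => i; have := eqn i.+1; rewrite !nth_nil.
- by move=> ->; rewrite IH // => i; have := eqn i.+1.
Qed.

Lemma size_frow mu w r : size w = sumn mu -> size (frow mu w r) = nth 0 mu r.
Proof.
move=> szw; rewrite -{2}(@reshapeKl _ mu w) ?szw // /frow.
have [lt_r|le_r] := ltnP r (size (reshape mu w)); first by rewrite (nth_map [::]).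
by rewrite !nth_default // size_map.
Qed.

Lemma nth_frow mu w r j : j < nth 0 mu r ->
  nth 0 (frow mu w r) j = nth 0 w (flatten_index mu r j).
Proof. by move=> lt_j; rewrite /frow nth_reshape nth_take // nth_drop. Qed.

Lemma frow_flatten rs r : frow (shape rs) (flatten rs) r = nth [::] rs r.
Proof. by rewrite /frow flattenK. Qed.

Lemma lt_count_sorted s N j : sorted leq s -> j < size s ->
  (nth 0 s j < N) = (j < count (fun x => x < N) s).
Proof.
elim: s j => // x s IH j so lt_j.
have so' := path_sorted so; have := order_path_min leq_trans so => /allP mins.
have [lt_x|le_x] := boolP (x < N).
  by rewrite /= lt_x; case: j lt_j => //= j lt_j; rewrite IH.
have -> : count (fun x => x < N) (x :: s) = 0.
  rewrite /= (negPf le_x); apply/eqP; rewrite -leqn0 leqNgt -has_count.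
  by apply/hasPn => y /mins le_xy; rewrite -leqNgt (leq_trans _ le_xy) // leqNgt.
rewrite ltn0; apply/negbTE; rewrite -leqNgt.
have : nth 0 (x :: s) j \in x :: s by apply: mem_nth.
rewrite inE => /orP[/eqP ->|/mins]; rewrite -leqNgt in le_x; lia.
Qed.

(* Column strictness read off the numbers of small entries in each row, as in
   a Gelfand-Tsetlin pattern. *)
Definition tableau (mu w : seq nat) : Prop :=
  [/\ size w = sumn mu, forall r, sorted leq (frow mu w r) &
      forall r N, count (fun x => x < N.+1) (frow mu w r.+1)
                  <= count (fun x => x < N) (frow mu w r)].

(** In a sorted row the entries below N fill an initial segment, so comparing counts in consecutive
    rows compares entries cell by cell. Strictness between distant rows follows through adjacent
    ones. *)
Lemma semistandardP mu w : (forall r, nth 0 mu r.+1 <= nth 0 mu r) ->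
  reflect (tableau mu w) (semistandard mu w).
Proof.
move=> decr.
have decr_le r k : nth 0 mu (k + r) <= nth 0 mu r.
  by elim: k => // k IH; exact: leq_trans (decr _) IH.
apply: (iffP andP) => [[/eqP szw /forallP cells]|[szw so cnt]].
  have cell r j r' j' : j < nth 0 mu r -> j' < nth 0 mu r' ->
      ((r == r') && (j < j') ==> (nth 0 (frow mu w r) j <= nth 0 (frow mu w r') j')) &&
      ((j == j') && (r < r') ==> (nth 0 (frow mu w r) j < nth 0 (frow mu w r') j')).
    move=> lt_j lt_j'; rewrite !nth_frow //.
    have := forallP (cells (Ordinal (flatten_indexP lt_j))) (Ordinal (flatten_indexP lt_j')).
    by rewrite /cell_row /cell_col /= !flatten_indexKl // !flatten_indexKr.
  have so r : sorted leq (frow mu w r).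
    apply/(sortedP 0) => j; rewrite size_frow // => lt_j.
    by have /andP[/implyP H _] := cell r j r j.+1 (ltnW lt_j) lt_j; apply: H; rewrite eqxx ltnSn.
  split=> // r N; rewrite leqNgt; apply/negP => lt_c.
  set X := frow mu w r in lt_c *; set X' := frow mu w r.+1 in lt_c *.
  (* If the inequality failed, column k would hold an entry at least N in row r and one at most N in
     row r + 1. *)
  set k := count _ X in lt_c *.
  have ltX' : k < nth 0 mu r.+1.
    by rewrite -(size_frow _ szw); apply: leq_trans lt_c (count_size _ _).
  have ltX : k < nth 0 mu r by apply: leq_trans ltX' (decr r).
  have lt1 : nth 0 X' k < N.+1 by rewrite (lt_count_sorted _ (so _)) ?(size_frow _ szw).
  have lt2 : ~~ (nth 0 X k < N) by rewrite (lt_count_sorted _ (so _)) ?ltnn ?(size_frow _ szw).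
  have /andP[_ /implyP H] := cell r k r.+1 k ltX ltX'.
  by have := H; rewrite eqxx ltnSn -/X -/X' => /(_ isT); lia.
split; first by rewrite szw.
have rowle r j j' : j <= j' -> j' < nth 0 mu r ->
    nth 0 (frow mu w r) j <= nth 0 (frow mu w r) j'.
  move=> le_j lt_j; apply: (sorted_leq_nth leq_trans leqnn) => //.
    by rewrite inE size_frow // (leq_ltn_trans le_j).
  by rewrite inE size_frow.
have adj r j : j < nth 0 mu r.+1 -> nth 0 (frow mu w r) j < nth 0 (frow mu w r.+1) j.
  move=> lt_j; have ltr : j < size (frow mu w r) by rewrite size_frow // (leq_trans lt_j).
  have ltr' : j < size (frow mu w r.+1) by rewrite size_frow.
  rewrite (lt_count_sorted _ (so r)) //; apply: leq_trans (cnt r _).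
  by rewrite -(lt_count_sorted _ (so r.+1)).
have colle k r j : j < nth 0 mu (k.+1 + r) ->
    nth 0 (frow mu w r) j < nth 0 (frow mu w (k.+1 + r)) j.
  elim: k => [|k IH] lt_j; first exact: adj.
  by apply: ltn_trans (IH _) (adj _ _ _) => //; apply: leq_trans lt_j (decr _).
apply/forallP => c; apply/forallP => d.
have ltc := reshape_offsetP (ltn_ord c); have ltd := reshape_offsetP (ltn_ord d).
rewrite /cell_row /cell_col -[in nth _ _ c](reshape_indexK mu c).
rewrite -[in nth _ _ d](reshape_indexK mu d) -!nth_frow //.
apply/andP; split; apply/implyP => /andP[/eqP eq_rc lt_rc].
  by rewrite eq_rc in ltc lt_rc *; apply: rowle => //; exact: ltnW.
rewrite eq_rc; rewrite -(subnK lt_rc) -addSnnS; apply: colle.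
by rewrite addSnnS subnK.
Qed.


Lemma sorted_split_max s N : sorted leq s -> all (fun x => x <= N) s ->
  s = [seq x <- s | x < N] ++ nseq (size s - count (fun x => x < N) s) N.
Proof.
elim: s => //= x s IH so /andP[le_x le_s].
have := IH (path_sorted so) le_s; case: ltnP => [lt_x|le_Nx] eqs.
  by rewrite /= add1n subSS -eqs.
have -> : x = N by lia.
suff s0 : [seq x <- s | x < N] = [::].
  by rewrite s0 -size_filter s0 subn0 /=; rewrite s0 -size_filter s0 subn0 in eqs; congr cons.
apply/eqP; rewrite -size_eq0 size_filter -leqn0 leqNgt -has_count.
apply/hasPn => y /(allP (order_path_min leq_trans so)); lia.
Qed.

Section Schur.
Variable n : nat.
Local Notation bpart := {ffun 'I_n.+1 -> 'I_n.+1}.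
Implicit Types (rho kap : bpart).

Definition prow rho := mkseq (pnth rho) n.+1.
(** Strips work with a fixed number of rows, while [is_part] forbids zero parts. *)
Definition trim rho := [seq x <- prow rho | x != 0].

Lemma nth_prow rho i : nth 0 (prow rho) i = pnth rho i.
Proof.
have [lt_i|le_i] := ltnP i n.+1; first by rewrite nth_mkseq.
by rewrite nth_default ?size_mkseq // pnth_out.
Qed.

Lemma sumn_prow rho : sumn (prow rho) = psize rho.
Proof. by rewrite sumnE /prow /mkseq big_map -/(index_iota 0 n.+1) big_mkord. Qed.

(** The filling of rho whose part of shape kap is [w] and whose cells in the strip rho / kap hold
    the letter N. *)
Definition glue N kap rho w := flatten (mkseq (fun r =>
  frow (prow kap) w r ++ nseq (pnth rho r - pnth kap r) N) n.+1).

Lemma frow_glue N kap rho w r : strip kap rho -> size w = psize kap ->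
  frow (prow rho) (glue N kap rho w) r
  = frow (prow kap) w r ++ nseq (pnth rho r - pnth kap r) N.
Proof.
move=> /stripP st szw; rewrite -sumn_prow in szw.
rewrite /glue; set F := (X in mkseq X _); have -> : prow rho = shape (mkseq F n.+1).
  rewrite /shape /prow /mkseq -map_comp; apply: eq_map => i /=.
  by rewrite size_cat size_nseq (size_frow _ szw) nth_prow subnKC //; case: (st i).
rewrite frow_flatten; have [lt_r|le_r] := ltnP r n.+1; first by rewrite nth_mkseq.
rewrite nth_default ?size_mkseq // !pnth_out //.
by apply/esym/eqP; rewrite cats0 -size_eq0 (size_frow _ szw) nth_prow pnth_out.
Qed.

Lemma flatten_frow mu w : size w = sumn mu ->
  flatten (mkseq (frow mu w) (size mu)) = w.
Proof.
move=> szw; rewrite -[RHS](@reshapeKr _ mu) ?szw //; congr flatten.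
by rewrite -(size_reshape mu w) mkseq_nth.
Qed.

Lemma count_flatten_mkseq (P : pred nat) F m :
  count P (flatten (mkseq F m)) = \sum_(i < m) count P (F i).
Proof. by rewrite count_flatten sumnE !big_map -[m in LHS]subn0 big_mkord. Qed.

Lemma count_glue (P : pred nat) N kap rho w : strip kap rho -> size w = psize kap ->
  count P (glue N kap rho w) = count P w + P N * (psize rho - psize kap).
Proof.
move=> st szw; rewrite -[in RHS](@flatten_frow (prow kap) w) ?sumn_prow //.
rewrite !size_mkseq !count_flatten_mkseq.
under eq_bigr => i _ do rewrite count_cat count_nseq.
rewrite big_split -big_distrr /=; congr (_ + _ * _).
rewrite /psize -sumnB // => i _; by case: (stripP _ _ st i).
Qed.

(** Removing the largest letter N = [size al] leaves a tableau of some shape kap. At level N the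
    count condition of [tableau] reads rho_(r+1) <= kap_r, so rho / kap is a horizontal strip, and
    [glue] inverts the removal. *)
Lemma count_semistandard_cons a al rho : (forall i, pnth rho i.+1 <= pnth rho i) ->
  count (semistandard (prow rho)) (permutations (cword (a :: al)))
  = \sum_(kap | strip kap rho && (psize rho == psize kap + a))
      count (semistandard (prow kap)) (permutations (cword al)).
Proof.
move=> decr; set N := size al.
have decr_nth mu : (forall i, pnth mu i.+1 <= pnth mu i) ->
    forall i, nth 0 (prow mu) i.+1 <= nth 0 (prow mu) i.
  by move=> dm i; rewrite !nth_prow.
pose ks := enum [pred kap : bpart | strip kap rho && (psize rho == psize kap + a)].
pose t kap := [seq v <- permutations (cword al) | semistandard (prow kap) v].
have t_facts kap v : kap \in ks -> v \in t kap ->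
   [/\ strip kap rho, psize rho = psize kap + a, perm_eq v (cword al),
       tableau (prow kap) v & forall r, all (fun x => x < N) (frow (prow kap) v r)].
  rewrite mem_enum inE mem_filter mem_permutations => /andP[st /eqP sz] /andP[ss pv].
  have tv : tableau (prow kap) v.
    by apply/semistandardP => //; apply: decr_nth; case: (strip_decr st).
  split=> // r; apply/allP => x xr; apply: (allP (cword_lt al)); rewrite -(perm_mem pv).
  case: tv => /flatten_frow <- _ _; apply/flattenP; exists (frow (prow kap) v r) => //.
  have [lt_r|le_r] := ltnP r n.+1.
    by apply/(nthP [::]); exists r; rewrite !size_mkseq ?nth_mkseq.
  move: xr; rewrite /frow nth_default ?size_reshape ?size_mkseq //.
rewrite (@count_decomp _ _ _ _ _ ks t (fun kap v => glue N kap rho v)).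
- rewrite big_enum_cond; apply: eq_big => [kap|kap _]; last by rewrite size_filter.
  by rewrite inE andbT.
- exact: permutations_uniq.
- exact: enum_uniq.
- by move=> kap; rewrite filter_uniq ?permutations_uniq.
- move=> kap v kap' v' /t_facts H /H[st sz pv [szv _ _] ltv] {H}.
  move=> /t_facts H /H[st' sz' pv' [szv' _ _] ltv'] {H} eqg.
  have szk := szv; have szk' := szv'.
  rewrite sumn_prow in szv; rewrite sumn_prow in szv'.
  have rows r : frow (prow kap) v r = frow (prow kap') v' r.
    have := frow_glue N r st szv; rewrite eqg frow_glue // => /(congr1 (filter (fun x => x < N))).
    have nil_f c : [seq x <- nseq c N | x < N] = [::] by rewrite filter_nseq ltnn.
    by rewrite !filter_cat !nil_f !cats0 !(all_filterP (ltv _)) !(all_filterP (ltv' _)).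
  split; last first.
    rewrite -[LHS](flatten_frow szk) -[RHS](flatten_frow szk') !size_mkseq.
    by congr flatten; apply: eq_mkseq.
  apply: eq_bpart => i _; rewrite -!nth_prow -(size_frow _ szk) -(size_frow _ szk').
  by rewrite rows.
- move=> kap v kin vin; have [st sz pv [szv sov cntv] ltv] := t_facts _ _ kin vin.
  rewrite sumn_prow in szv.
  split.
    rewrite mem_permutations; apply/seq.permP => P.
    rewrite count_glue // /= count_cat count_nseq (seq.permP pv); congr (_ + _ * _).
    by rewrite sz addKn.
  apply/semistandardP; first exact: decr_nth.
  split=> [|r|r M].
  - by rewrite -count_predT count_glue // count_predT mul1n szv sumn_prow sz addKn.
  - rewrite frow_glue // (sorted_pairwise leq_trans) pairwise_cat.
    rewrite -!(sorted_pairwise leq_trans) sov /=; apply/andP; split.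
      apply/allrelP => x y /(allP (ltv r)) lt_x; rewrite mem_nseq => /andP[_ /eqP ->].
      exact: ltnW.
    by elim: (_ - _) => //= -[|c] //= ->; rewrite leqnn.
  - rewrite !frow_glue // !count_cat.
    have [lt_MN|le_NM] := ltnP M N.
      rewrite [X in _ + X <= _]count_nseq /= [N < _]ltnS [N <= _]leqNgt lt_MN mul0n addn0.
      exact: leq_trans (cntv r M) (leq_addr _ _).
    (* For M >= N the whole of row r of kap is counted, and the strip condition bounds the whole of
       row r + 1 of rho by it. *)
    apply: (@leq_trans (pnth kap r)).
      have [_ le_k] := stripP _ _ st r; apply: leq_trans le_k.
      rewrite -count_cat; apply: leq_trans (count_size _ _) _.
      rewrite size_cat size_nseq (size_frow _) ?sumn_prow // nth_prow subnKC //.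
      by case: (stripP _ _ st r.+1).
    rewrite (_ : count _ (frow _ _ r) = pnth kap r) ?leq_addr //.
    rewrite -nth_prow -(@size_frow _ v) ?sumn_prow //; apply/eqP; rewrite -all_count.
    by apply: sub_all (ltv r) => x lt_x; apply: leq_trans lt_x le_NM.
move=> w; rewrite mem_permutations => pw /(semistandardP _ (decr_nth _ decr))[szw sow cntw].
have szw' := szw; rewrite sumn_prow in szw'.
have lew r : all (fun x => x <= N) (frow (prow rho) w r).
  apply/allP => x xr; have := cword_lt (a :: al) => /allP/(_ x); apply; rewrite -(perm_mem pw).
  rewrite -(flatten_frow szw); apply/flattenP; exists (frow (prow rho) w r) => //.
  have [lt_r|le_r] := ltnP r n.+1.
    by apply/(nthP [::]); exists r; rewrite !size_mkseq ?nth_mkseq.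
  by move: xr; rewrite /frow nth_default ?size_reshape ?size_mkseq.
have szr r : size (frow (prow rho) w r) = pnth rho r by rewrite (size_frow _ szw) nth_prow.
pose c r := count (fun x => x < N) (frow (prow rho) w r).
have le_c r : c r <= pnth rho r by rewrite -szr count_size.
pose kap : bpart := mkpart n c.
have kapE r : pnth kap r = c r.
  have [le_r|lt_r] := leqP r n; first by rewrite pnth_mkpart // (leq_trans (le_c r)) ?pnth_le.
  by rewrite pnth_out //; have := le_c r; rewrite pnth_out // leqn0 => /eqP.
pose v := [seq x <- w | x < N].
have fl_v : v = flatten (mkseq (fun r => [seq x <- frow (prow rho) w r | x < N]) n.+1).
  rewrite /v -{1}(flatten_frow szw) filter_flatten size_mkseq /mkseq -map_comp.
  by [].
have frow_v r : frow (prow kap) v r = [seq x <- frow (prow rho) w r | x < N].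
  rewrite fl_v; set F := mkseq _ _; have -> : prow kap = shape F.
    by rewrite /shape /F /prow /mkseq -map_comp; apply: eq_map => i /=; rewrite size_filter kapE.
  rewrite frow_flatten; have [lt_r|le_r] := ltnP r n.+1; first by rewrite nth_mkseq.
  rewrite nth_default ?size_mkseq //; apply/esym/eqP; rewrite -size_eq0 size_filter.
  by have := le_c r; rewrite pnth_out // leqn0.
have pv : perm_eq v (cword al).
  have := perm_filter (fun x => x < N) pw; rewrite /= filter_cat filter_nseq ltnn cats0.
  by rewrite (all_filterP (cword_lt al)).
have szv : size v = psize kap.
  rewrite fl_v size_flatten sumnE /shape /mkseq -map_comp big_map -/(index_iota 0 n.+1) big_mkord.
  by apply: eq_bigr => i _; rewrite /= size_filter kapE.
have st : strip kap rho.
  apply/stripP => r; rewrite kapE; split=> //.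
  rewrite -szr; apply: leq_trans (cntw r N).
  by rewrite -size_filter (all_filterP (lew r.+1)).
exists kap, v; split.
- rewrite mem_enum inE st /= -szw' -szv (perm_size pw) (perm_size pv) !size_cword /= addnC.
  by [].
- rewrite mem_filter mem_permutations pv andbT; apply/semistandardP.
    by apply: decr_nth; case: (strip_decr st).
  split=> [|r|r M]; first by rewrite sumn_prow.
    by rewrite frow_v; apply: (sorted_filter leq_trans).
  rewrite !frow_v !count_filter; have [lt_MN|le_NM] := ltnP M N.
    apply: (@leq_trans (count (fun x => x < M.+1) (frow (prow rho) w r.+1))).
      by apply: sub_count => x /andP[].
    apply: leq_trans (cntw r M) _; apply: sub_count => x lt_x.
    by apply/andP; split=> //=; apply: ltn_trans lt_x lt_MN.
  apply: (@leq_trans (count (fun x => x < N.+1) (frow (prow rho) w r.+1))).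
    by apply: sub_count => x /andP[_ /=]; apply: ltnW.
  apply: leq_trans (cntw r N) _; apply: sub_count => x lt_x.
  by apply/andP; split=> //=; apply: leq_trans lt_x le_NM.
rewrite -[LHS](flatten_frow szw) size_mkseq; congr flatten; apply: eq_mkseq => r.
by rewrite frow_v kapE -szr; apply: sorted_split_max.
Qed.

Definition decreasing rho := [forall i : 'I_n.+1, pnth rho i.+1 <= pnth rho i].

Lemma decreasingP rho :
  reflect (forall i, pnth rho i.+1 <= pnth rho i) (decreasing rho).
Proof.
apply: (iffP forallP) => [H i|H i]; last exact: H.
have [lt_i|le_i] := ltnP i n.+1; first exact: H (Ordinal lt_i).
by rewrite !pnth_out // ltnW.
Qed.

Lemma nchain_decreasing al rho : nchain al rho != 0 -> decreasing rho.
Proof.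
move=> nz; apply/decreasingP => i; case: al nz => [|a al] /=.
  rewrite /empty_part eqb0 negbK sum_nat_eq0 => /forallP z.
  have [lt_i|le_i] := ltnP i.+1 n.+1; last by rewrite pnth_out.
  by rewrite (eqP (z (Ordinal lt_i))).
rewrite -lt0n lt0n sum_nat_eq0 => /forallPn[kap].
by rewrite negb_imply => /andP[/andP[/strip_decr[_ ->]]].
Qed.

Lemma count_semistandard al rho : decreasing rho ->
  count (semistandard (prow rho)) (permutations (cword al)) = nchain al rho.
Proof.
elim: al rho => [|a al IH] rho dr.
  rewrite /permutations /= addn0 /empty_part /semistandard sumn_prow eq_sym.
  case: eqP => //= sz0.
  by apply/eqP; rewrite eqb1; apply/forallP => -[c lt_c]; exfalso; move: lt_c; rewrite sz0.
rewrite count_semistandard_cons; last exact/decreasingP.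
apply: eq_bigr => kap /andP[/strip_decr[dk _] _]; rewrite IH //; exact/decreasingP.
Qed.

Lemma nth_trim rho i : decreasing rho -> nth 0 (trim rho) i = pnth rho i.
Proof.
move=> /decreasingP dr; rewrite -nth_prow /trim.
have : forall j, nth 0 (prow rho) j.+1 <= nth 0 (prow rho) j by move=> j; rewrite !nth_prow.
elim: (prow rho) i => [|x s IH] i ds //=.
have ds' j : nth 0 s j.+1 <= nth 0 s j by exact: ds j.+1.
case: (eqVneq x 0) => [x0|nz_x] /=; last by case: i => //= i; rewrite IH.
have s0 j : nth 0 (x :: s) j = 0.
  by elim: j => // j IHj; apply/eqP; rewrite -leqn0; apply: leq_trans (ds j) _; rewrite IHj.
by rewrite IH // s0; exact: s0 i.+1.
Qed.

Lemma sumn_trim rho : sumn (trim rho) = psize rho.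
Proof. by rewrite -sumn_prow /trim; elim: (prow rho) => //= -[|x] s IH //=; rewrite IH. Qed.

Lemma is_part_trim rho : decreasing rho -> is_part (psize rho) (trim rho).
Proof.
move=> dr; rewrite /is_part sumn_trim eqxx andbT mem_filter eqxx andbT.
apply: sorted_filter => [x y z /= le_yx le_xz|]; first exact: leq_trans le_xz le_yx.
by apply/(sortedP 0) => i _; rewrite !nth_prow; apply/decreasingP.
Qed.

Lemma semistandard_trim rho w : decreasing rho ->
  semistandard (trim rho) w = semistandard (prow rho) w.
Proof.
move=> dr; have /decreasingP dr' := dr.
have en : nth 0 (trim rho) =1 nth 0 (prow rho) by move=> i; rewrite nth_trim // nth_prow.
apply/semistandardP/semistandardP => [|i|[sz so cnt]|[sz so cnt]].
- by move=> i; rewrite !nth_trim.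
- by rewrite !nth_prow.
- split=> [|r|r N]; first by rewrite sz sumn_trim sumn_prow.
    by rewrite -(eq_frow w r en).
  by rewrite -!(eq_frow w _ en).
- split=> [|r|r N]; first by rewrite sz sumn_trim sumn_prow.
    by rewrite (eq_frow w r en).
  by rewrite !(eq_frow w _ en).
Qed.

(** The count of words is the Kostka number K_(rho, la), since [cword (rev la)] has la_r letters r.
    Together with [schur_trim] this is the expansion of h_la in Schur functions, coefficient by
    coefficient. *)
Lemma ntable_count_semistandard la al : sumn la = n ->
  ntable la al = \sum_(rho : bpart | decreasing rho && (psize rho == n))
     count (semistandard (trim rho)) (permutations (cword (rev la))) * nchain al rho.
Proof.
move=> sum_la; rewrite -ntable_rev (@ntable_nchain n) ?sumn_rev ?sum_la //.
rewrite /dot [RHS]big_mkcond; apply: eq_bigr => rho _ /=.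
case: ifP => [/andP[dr /eqP sz]|/negP nr].
  by rewrite -count_semistandard //; congr (_ * _); apply: eq_count => w; rewrite semistandard_trim.
have [->|nz] := eqVneq (nchain (rev la) rho) 0; first by [].
by case: nr; rewrite (nchain_decreasing nz) (nchain_supp nz) sumn_rev sum_la eqxx.
Qed.

End Schur.

(** * Tabloids as words of row indices *)

Lemma mkseq_cell_row la : mkseq (cell_row la) (sumn la) = cword (rev la).
Proof.
elim/last_ind: la => [|la x IH] //; rewrite rev_rcons /= size_rev -IH sumn_rcons.
have shift r j : r < size la -> flatten_index (rcons la x) r j = flatten_index la r j.
  by move=> lt_r; rewrite /flatten_index -cats1 takel_cat // ltnW.
rewrite /mkseq iotaD map_cat; congr (_ ++ _).
  apply/eq_in_map => c; rewrite mem_iota add0n => /andP[_ lt_c].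
  rewrite /cell_row -{1}(reshape_indexK la c) -shift ?reshape_indexP //.
  by rewrite flatten_indexKl // nth_rcons reshape_indexP // reshape_offsetP.
rewrite add0n -[LHS]map_id; apply: (@eq_from_nth _ 0); rewrite ?size_map ?size_iota ?size_nseq //.
move=> j lt_j; rewrite map_id (nth_map 0) ?size_iota // nth_iota // nth_nseq lt_j.
have -> : sumn la + j = flatten_index (rcons la x) (size la) j.
  by rewrite /flatten_index -cats1 take_size_cat.
by rewrite /cell_row flatten_indexKl // nth_rcons ltnn eqxx.
Qed.

Section TabloidWords.
Local Open Scope group_scope.
Variables (n : nat) (la : seq nat).
Hypothesis sum_la : sumn la = n.
Implicit Types (T U s : 'S_n) (t u : tabloid n la).

Lemma row_equivE T U :
  row_equiv la T U = [forall i, cell_row la (T^-1 i) == cell_row la (U^-1 i)].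
Proof.
have memr V r i : (i \in row_letters la V r) = (cell_row la (V^-1 i) == r).
  apply/imsetP/idP => [[c]|rc]; first by rewrite inE => rc ->; rewrite permK.
  by exists (V^-1 i); rewrite ?permKV // inE.
apply/forallP/forallP => [H i|H r]; last first.
  by apply/eqP/setP => i; rewrite !memr (eqP (H i)).
have lt_r : cell_row la (T^-1 i) < size la by apply: reshape_indexP; rewrite sum_la.
by have /eqP/setP/(_ i) := H (Ordinal lt_r); rewrite !memr eqxx eq_sym => <-.
Qed.

Lemma tabloidP t : exists T, t = tabloid_of la T.
Proof.
case: t => A tA; have /imsetP[T _ eqA] := tA.
by exists T; apply: val_inj; rewrite /= eqA; apply/setP => U; rewrite !inE.
Qed.

Lemma mem_tabloid_of T U : (U \in val (tabloid_of la T)) = row_equiv la T U.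
Proof. by rewrite inE. Qed.

(** Read off a filling picked in the class; [trow_of] shows the choice to be immaterial. *)
Definition trow t (i : 'I_n) : nat := cell_row la ((odflt 1 [pick T in val t])^-1 i).

Lemma trow_of T i : trow (tabloid_of la T) i = cell_row la (T^-1 i).
Proof.
rewrite /trow; case: pickP => [U|/(_ T)] /=; rewrite mem_tabloid_of row_equivE.
  by move/forallP/(_ i)/eqP.
by move/negbT/forallPn => [j]; rewrite eqxx.
Qed.

Lemma trow_inj t u : trow t =1 trow u -> t = u.
Proof.
have [T ->] := tabloidP t; have [U ->] := tabloidP u => eqTU.
have e i : cell_row la (T^-1 i) = cell_row la (U^-1 i) by rewrite -!trow_of.
by apply: val_inj; apply/setP => V; rewrite !inE !row_equivE; apply: eq_forallb => i; rewrite e.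
Qed.

Lemma trow_act s t i : trow (tabloid_act s t) i = trow t (s^-1 i).
Proof.
by have [T ->] := tabloidP t; rewrite tabloid_act_of !trow_of invMg permM.
Qed.

Lemma tabloid_act1 t : tabloid_act 1 t = t.
Proof. by have [T ->] := tabloidP t; rewrite tabloid_act_of mulg1. Qed.

Lemma tabloid_actM s s' t : tabloid_act s' (tabloid_act s t) = tabloid_act (s * s') t.
Proof. by have [T ->] := tabloidP t; rewrite !tabloid_act_of mulgA. Qed.

Lemma mem_tabloid t T : (T \in val t) = [forall i, trow t i == cell_row la (T^-1 i)].
Proof.
have [U ->] := tabloidP t; rewrite mem_tabloid_of row_equivE.
by apply: eq_forallb => i; rewrite trow_of.
Qed.

Lemma tabloid_fun (f : 'I_n -> nat) :
  perm_eq [seq f i | i <- enum 'I_n] [seq cell_row la i | i : 'I_n <- enum 'I_n] ->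
  exists t, trow t =1 f.
Proof.
pose w0 := [tuple cell_row la i | i < n]; pose w := [tuple f i | i < n].
move=> pw; have /tuple_permP[p eqw] : perm_eq w w0 by [].
exists (tabloid_of la p^-1) => i; rewrite trow_of invgK.
have /val_inj/(congr1 (fun x => tnth x i)) : val w = [tuple tnth w0 (p i) | i < n] by [].
by rewrite !tnth_mktuple.
Qed.

Definition tword t : seq nat := [seq trow t i | i <- enum 'I_n].

Lemma nth_tword t (i : 'I_n) : nth 0 (tword t) i = trow t i.
Proof. by rewrite (nth_map i) ?size_enum_ord // nth_ord_enum. Qed.

Lemma size_tword t : size (tword t) = n.
Proof. by rewrite size_map size_enum_ord. Qed.

Lemma map_cell_row : [seq cell_row la i | i : 'I_n <- enum 'I_n] = cword (rev la).
Proof. by rewrite -mkseq_cell_row sum_la /mkseq -val_enum_ord -map_comp. Qed.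

Lemma perm_tword t : perm_eq (tword t) (cword (rev la)).
Proof.
have [T ->] := tabloidP t; rewrite -map_cell_row.
pose w0 := [tuple cell_row la i | i < n].
have : perm_eq [tuple trow (tabloid_of la T) i | i < n] w0; last by [].
apply/tuple_permP; exists T^-1; congr val; apply: eq_from_tnth => i.
by rewrite !tnth_mktuple trow_of.
Qed.

(** [tword] is a bijection from the tabloids onto the rearrangements of the word with la_r letters
    r. *)
Lemma count_tword (Q : pred (seq nat)) :
  count Q (permutations (cword (rev la))) = #|[pred t : tabloid n la | Q (tword t)]|.
Proof.
rewrite cardE -size_filter -[RHS](size_map tword); apply: perm_size; apply: uniq_perm.
- by rewrite filter_uniq ?permutations_uniq.
- rewrite map_inj_uniq ?enum_uniq // => t u eqw; apply: trow_inj => i.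
  by rewrite -!nth_tword eqw.
move=> w; rewrite mem_filter mem_permutations.
apply/andP/mapP => [[Qw pw]|[t]]; last first.
  by rewrite mem_enum inE => Qt ->; rewrite Qt perm_tword.
have szw : size w = n by rewrite (perm_size pw) size_cword sumn_rev.
have eqw : w = [seq nth 0 w i | i : 'I_n].
  apply: (@eq_from_nth _ 0) => [|i lt_i]; first by rewrite size_map size_enum_ord.
  rewrite szw in lt_i; rewrite (nth_map (Ordinal lt_i)) ?size_enum_ord //.
  by rewrite nth_enum_ord.
have [t rt] : exists t, trow t =1 (fun i : 'I_n => nth 0 w i).
  by apply: tabloid_fun; rewrite map_cell_row; move: pw; rewrite {1}eqw.
have wt : w = tword t by rewrite {1}eqw; apply: eq_map => i; rewrite rt.
by exists t; rewrite // mem_enum inE -wt.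
Qed.

End TabloidWords.

(** * Sorting the columns of a filling *)

Lemma leq_sum_eq (I : finType) (E1 E2 : I -> nat) :
  (forall i, E1 i <= E2 i) -> \sum_i E2 i <= \sum_i E1 i -> E1 =1 E2.
Proof.
move=> le12 le21 i; apply/eqP; rewrite eqn_leq le12 leqNgt; apply/negP => lt_i.
move: le21; rewrite (bigD1 i) // [X in _ <= X](bigD1 i) //=.
have : \sum_(j | j != i) E1 j <= \sum_(j | j != i) E2 j by apply: leq_sum.
lia.
Qed.

Section Shape.
Variables (n : nat) (mu : seq nat).
Hypotheses (sum_mu : sumn mu = n) (decr_mu : forall r, nth 0 mu r.+1 <= nth 0 mu r).
Implicit Types (c d : 'I_n) (s : 'S_n) (f g : 'I_n -> nat).

Local Notation row := (cell_row mu).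
Local Notation col := (cell_col mu).

Lemma cell_inj c d : row c = row d -> col c = col d -> c = d.
Proof.
move=> er ec; apply: val_inj.
by rewrite /= -(reshape_indexK mu c) -(reshape_indexK mu d) [reshape_index _ _]er
  [reshape_offset _ _]ec.
Qed.

Lemma cell_up c r : row c = r.+1 -> exists2 d : 'I_n, row d = r & col d = col c.
Proof.
move=> rc; have lt_c : c < sumn mu by rewrite sum_mu.
have lt_col : col c < nth 0 mu r.
  by apply: leq_trans (decr_mu r); rewrite -rc; apply: reshape_offsetP.
have lt_n : flatten_index mu r (col c) < n by rewrite -[in X in _ < X]sum_mu flatten_indexP.
by exists (Ordinal lt_n); rewrite /cell_row /cell_col /= ?flatten_indexKl ?flatten_indexKr.
Qed.

Definition colperm s := [forall c, col (s c) == col c].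
Definition rowperm s := [forall c, row (s c) == row c].

Lemma colpermM s s' : colperm s -> colperm s' -> colperm (s * s')%g.
Proof.
move=> /forallP h /forallP h'; apply/forallP => c.
by rewrite permM (eqP (h' _)) h.
Qed.

Lemma colpermV s : colperm s -> colperm s^-1%g.
Proof. by move=> /forallP h; apply/forallP => c; rewrite eq_sym -{1}(permKV s c) h. Qed.

Lemma colperm1 : colperm 1%g.
Proof. by apply/forallP => c; rewrite perm1. Qed.

Lemma colperm_tperm c d : col c = col d -> colperm (tperm c d).
Proof. by move=> ec; apply/forallP => i; case: tpermP => [->|->|]; rewrite ?ec. Qed.

Definition col_strict f := forall c d, col c = col d -> row c < row d -> f c < f d.
Definition row_weak f := forall c d, row c = row d -> col c < col d -> f c <= f d.

(** Row permutations leave it unchanged, and it grows when larger entries move further down a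
    column. *)
Definition weight f := \sum_(c < n) row c * f c.

(* A column permutation maximizing the weight sorts the columns, since any
   inversion could be swapped. *)
Lemma max_weight_strict f s :
  (forall c d, col c = col d -> f c = f d -> c = d) -> colperm s ->
  (forall s', colperm s' -> weight (f \o s') <= weight (f \o s)) ->
  col_strict (f \o s).
Proof.
move=> inj_f cs max_s c d ec lt_r; rewrite ltnNge; apply/negP => /= le_f.
have ne_cd : c != d by apply: contraTneq lt_r => ->; rewrite ltnn.
have cols i : col (s i) = col i by apply/eqP/(forallP cs).
have lt_f : f (s d) < f (s c).
  rewrite ltn_neqAle le_f andbT; apply: contra ne_cd => /eqP ef.
  by apply/eqP/(@perm_inj _ s)/esym/inj_f; rewrite ?cols.
have := max_s (tperm c d * s)%g (colpermM (colperm_tperm ec) cs).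
have split_w (g : 'I_n -> nat) : weight g = row c * g c + (row d * g d
    + \sum_(i < n | (i != c) && (i != d)) row i * g i).
  by rewrite /weight (bigD1 c) // (bigD1 d) //= eq_sym.
rewrite !split_w /= !permM tpermL tpermR.
rewrite (eq_bigr (fun i : 'I_n => row i * f (s i))) => [|i /andP[nc nd]]; last first.
  by rewrite /= permM tpermD // eq_sym.
move: (bigop _ _ _) => S0.
have : row c * f (s c) + row d * f (s d) < row c * f (s d) + row d * f (s c) by nia.
lia.
Qed.

(** The [row c] cells above c in its column carry strictly smaller natural numbers. *)
Lemma col_strict_ge f : col_strict f -> forall c : 'I_n, row c <= f c.
Proof.
move=> str c; move: {2}(row c) (leqnn (row c)) => k; elim: k c => [|k IH] c le_k; first by lia.
case er: (row c) => [|r] //; have [d rd cd] := cell_up er.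
have := str d c cd; rewrite rd er ltnSn => /(_ isT); apply: leq_ltn_trans.
by rewrite -rd; apply: IH; lia.
Qed.

Lemma sum_perm f s : \sum_c f (s c) = \sum_c f c.
Proof. by rewrite [RHS](reindex_inj (@perm_inj _ s)). Qed.

(** Strictness gives [row c <= row (s c)] in every cell, and both sides have the same total; so s
    keeps rows as well as columns. *)
Lemma colperm_strict1 s : colperm s -> col_strict (fun c : 'I_n => row (s c)) -> s = 1%g.
Proof.
move=> cs str; apply/permP => c; rewrite perm1.
have /(_ c) er : (fun c : 'I_n => row c) =1 (fun c => row (s c)).
  apply: leq_sum_eq; first exact: col_strict_ge str.
  by rewrite (sum_perm (fun c : 'I_n => row c)).
by apply: cell_inj; [rewrite -er | apply/eqP/(forallP cs)].
Qed.

Lemma sort_columns f : (forall c d, col c = col d -> f c = f d -> c = d) ->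
  exists s, [/\ colperm s, col_strict (f \o s) &
    forall s', colperm s' -> weight (f \o s') <= weight (f \o s)].
Proof.
move=> inj_f; case: (arg_maxnP (fun s => weight (f \o s)) colperm1) => s cs max_s.
by exists s; split=> //; apply: max_weight_strict.
Qed.

Lemma col_strict_inj f : col_strict f -> forall c d, col c = col d -> f c = f d -> c = d.
Proof.
move=> str c d ec ef; apply: cell_inj => //; apply/eqP.
by case: (ltngtP (row c) (row d)) => // lt_r; have := str _ _ _ lt_r;
  rewrite ec ef ltnn => /(_ erefl).
Qed.

(** Any s' maximizing the weight makes f o s' column strict by [max_weight_strict]. With f strict
    too, s' preserves the order of rows within columns, hence is the identity. *)
Lemma col_strict_max f s : col_strict f -> colperm s ->
  weight (f \o s) <= weight f /\ (weight (f \o s) = weight f -> s = 1%g).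
Proof.
move=> str; have inj_f := col_strict_inj str.
have max1 s' : colperm s' ->
    (forall s2, colperm s2 -> weight (f \o s2) <= weight (f \o s')) -> s' = 1%g.
  move=> cs' max_s'; have str' := max_weight_strict inj_f cs' max_s'.
  apply: colperm_strict1 => // c d ec lt_r; have /= lt_f := str' c d ec lt_r.
  have ec' : col (s' c) = col (s' d) by rewrite !(eqP (forallP cs' _)).
  case: (ltngtP (row (s' c)) (row (s' d))) => // [lt_r'|er].
    by have := str _ _ (esym ec') lt_r'; lia.
  by move: lt_f; rewrite (cell_inj er ec') ltnn.
have [s0 [cs0 _ max_s0]] := sort_columns inj_f; have e0 := max1 s0 cs0 max_s0.
have w1 : weight (f \o (1%g : 'S_n)) = weight f by apply: eq_bigr => c _; rewrite /= perm1.
rewrite {}e0 w1 in max_s0; move=> cs; split=> [|ew]; first exact: max_s0.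
by apply: max1 => // s2 /max_s0; rewrite ew.
Qed.

(** Each row of f and of g is the increasing arrangement of the same multiset. *)
Lemma row_weak_eq f g s : row_weak f -> row_weak g -> rowperm s -> f =1 g \o s -> f =1 g.
Proof.
move=> wf wg rs fg.
have half (f1 g1 : 'I_n -> nat) s1 : row_weak f1 -> row_weak g1 -> rowperm s1 ->
    f1 =1 g1 \o s1 -> forall c, f1 c <= g1 c.
  move=> wf1 wg1 rs1 fg1 c; rewrite leqNgt; apply/negP => lt_c.
  (* If f1 c > g1 c, the cells of B are strictly left of c, hence in A, while c is in A only; yet s1
     maps B bijectively onto A. *)
  pose A := [set d : 'I_n | (row d == row c) && (g1 d <= g1 c)].
  pose B := [set d : 'I_n | (row d == row c) && (f1 d <= g1 c)].
  have cAB : #|A| = #|B|.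
    rewrite -(card_preimset A (@perm_inj _ s1)); apply: eq_card => d.
    by rewrite !inE (eqP (forallP rs1 d)) fg1.
  suff /proper_card : B \proper A by rewrite cAB ltnn.
  apply/properP; split; last by exists c; rewrite inE eqxx ?leqnn // -ltnNge.
  apply/subsetP => d; rewrite !inE => /andP[/eqP er le_f]; rewrite er eqxx /=.
  case: (ltngtP (col d) (col c)) => [lt_d|lt_d|ec]; first exact: wg1.
    by have := wf1 c d (esym er) lt_d; lia.
  by rewrite (cell_inj er ec).
move=> c; apply/eqP; rewrite eqn_leq (half f g s) //=.
apply: (half g f s^-1%g) => // [|d]; last by rewrite /= fg /= permKV.
by apply/forallP => d; rewrite eq_sym -{1}(permKV s d) (forallP rs).
Qed.

(** As s' preserves rows, g has the weight of f o s, which by [col_strict_max] is below that of f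
    unless s = 1. This one comparison gives the triangularity both of the maps S^mu -> M^la and of
    the standard polytabloids. *)
Lemma tableau_triangular f g s s' :
  col_strict f -> row_weak f -> row_weak g -> colperm s -> rowperm s' ->
  (forall c, f (s c) = g (s' c)) ->
  (weight g < weight f) \/ (s = 1%g /\ f =1 g).
Proof.
move=> str wf wg cs rs' eq_fg; have [le_w eq_w] := col_strict_max str cs.
have wgE : weight g = weight (f \o s).
  rewrite /weight -(sum_perm (fun c : 'I_n => row c * g c) s'); apply: eq_bigr => c _.
  by rewrite /= eq_fg (eqP (forallP rs' c)).
rewrite wgE; move: le_w; rewrite leq_eqVlt => /orP[/eqP /eq_w s1|]; last by left.
by right; split=> //; apply: (@row_weak_eq f g s') => // c; rewrite /= -eq_fg s1 perm1.
Qed.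

Lemma sort_columns_ge f : (forall c d, col c = col d -> f c = f d -> c = d) ->
  exists2 s, colperm s & (forall c : 'I_n, row c <= f (s c)).
Proof.
by move=> /sort_columns[s [cs str _]]; exists s => // c; apply: (col_strict_ge str).
Qed.

Lemma semistandard_strict w : semistandard mu w ->
  col_strict (fun c : 'I_n => nth 0 w c) /\ row_weak (fun c : 'I_n => nth 0 w c).
Proof.
rewrite /semistandard => /andP[_ /forallP H].
split=> c d e1 e2.
  have [cm dm] : c < sumn mu /\ d < sumn mu by rewrite sum_mu.
  have /andP[_] := forallP (H (Ordinal cm)) (Ordinal dm).
  by rewrite /= e1 eqxx e2.
have [cm dm] : c < sumn mu /\ d < sumn mu by rewrite sum_mu.
have /andP[] := forallP (H (Ordinal cm)) (Ordinal dm).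
by rewrite /= e1 eqxx e2.
Qed.

End Shape.

(** * Coefficients of products of complete symmetric functions and of Schur functions *)

Local Open Scope ring_scope.

(** By [cmsetP] a series is known from its values here. The list is not unique: zeros may be put in
    front of it. *)
Definition cmset (al : seq nat) : {mset nat}%mset := seq_mset (cword al).

Lemma word_sum_seq_mset P s : word_sum P (seq_mset s) = (count P (permutations s))%:R.
Proof.
rewrite /word_sum; congr (_%:R); apply/seq.permP/perm_permutations.
exact: perm_eq_seq_mset.
Qed.

Lemma cmsetP (m : {mset nat}%mset) : exists al, m = cmset al.
Proof.
exists (content (\max_(x <- m) x).+1 m); rewrite -[LHS]seq_mset_id.
apply/eq_seq_msetP/perm_cword_content/allP => x xm.
by rewrite ltnS (big_rem x) //= leq_maxl.
Qed.

Lemma size_cmset al : size (cmset al) = sumn al.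
Proof. by rewrite (perm_size (perm_eq_seq_mset _)) size_cword. Qed.

Lemma complete_symE k al : complete_sym k (cmset al) = (sumn al == k)%:R.
Proof.
rewrite /complete_sym word_sum_seq_mset; congr (_%:R).
transitivity (count (fun w => (sumn al == k) && (w == cword al)) (permutations (cword al))).
  apply: eq_in_count => w; rewrite mem_permutations => pw /=.
  rewrite (perm_size pw) size_cword; congr (_ && _).
  apply/idP/eqP => [so|->]; last exact: sorted_cword.
  exact: (sorted_eq leq_trans anti_leq so (sorted_cword al) pw).
case: eqP => _ /=; last by rewrite count_pred0.
by rewrite count_uniq_mem ?permutations_uniq // mem_permutations perm_refl.
Qed.

(** Turns the index set of [fps_mul], made of submultisets, into that of [peel]. *)
Lemma perm_divisors al :
  perm_eq (undup [seq seq_mset (mask (tval b) (cmset al))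
                     | b <- enum {: (size (cmset al)).-tuple bool}])
          [seq cmset ga | ga <- subvecs al].
Proof.
apply: uniq_perm; first exact: undup_uniq.
  rewrite map_inj_in_uniq ?uniq_subvecs // => ga ga' gain gain' /eq_seq_msetP.
  by apply: cword_inj; rewrite (size_subvecs gain) (size_subvecs gain').
move=> a; rewrite mem_undup; apply/mapP/mapP => [[b _ ->]|[ga gain ->]].
  have [] := @content_subvecs al (mask b (cmset al)).
    move=> j; rewrite -(seq.permP (perm_eq_seq_mset (cword al))).
    by apply: leq_count_subseq; apply: mask_subseq.
  set ga := content _ _ => gain pga; exists ga => //; exact/eq_seq_msetP.
have [|s /subseqP[b szb ->] pga] := (count_subseqP (cword ga) (cmset al)).1.
  move=> j; rewrite (seq.permP (perm_eq_seq_mset (cword al))).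
  by rewrite -(count_cword_subvec j gain) leq_addr.
exists (Tuple (introT eqP szb)); first by rewrite mem_enum.
exact/eq_seq_msetP.
Qed.

Lemma fps_mul_complete k (f : fps) (g : seq nat -> nat) al :
  (forall be, f (cmset be) = (g be)%:R) ->
  fps_mul (complete_sym k) f (cmset al) = (peel k g al)%:R.
Proof.
move=> fg; rewrite /fps_mul (perm_big _ (perm_divisors al)) big_map /=.
rewrite /peel natr_sum [RHS]big_mkcond big_seq [RHS]big_seq.
apply: eq_bigr => ga gain; rewrite complete_symE; case: eqP => _; last by rewrite mul0r.
rewrite mul1r -fg; congr f; apply/msetP => j.
by rewrite msetE2 !mset_seqE -(count_cword_subvec j gain) addKn.
Qed.

Lemma complete_sym_partE la al : complete_sym_part la (cmset al) = (ntable la al)%:R.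
Proof.
rewrite /complete_sym_part; elim: la al => [|k la IH] al /=.
  rewrite big_nil /fps_one -size_mset_eq0 size_cmset; by case: eqP.
by rewrite big_cons; apply: fps_mul_complete.
Qed.

Lemma schur_trim n al (rho : {ffun 'I_n.+1 -> 'I_n.+1}) : decreasing rho ->
  schur (trim rho) (cmset al) = (nchain al rho)%:R.
Proof.
move=> dr; rewrite /schur /cmset word_sum_seq_mset -count_semistandard //.
by congr (_%:R); apply: eq_count => w; apply: semistandard_trim.
Qed.

(** * Coordinates and linear extension on tabloid modules *)

Section TabloidModule.
Variables (F : fieldType) (n : nat) (la : seq nat).
Local Notation M := (tabloid_mod n la F).
Local Notation vec := (@tabloid_vec n la F).
Implicit Types (v : M) (t u : tabloid n la).

Definition tcoef t v : F := (v : {ffun tabloid n la -> F^o}) t.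

Lemma tcoef_vec t u : tcoef t (vec u) = (t == u)%:R.
Proof. by rewrite /tcoef ffunE. Qed.

Fact tcoef_linear t : linear_for *%R (tcoef t).
Proof. by move=> a u v; rewrite /tcoef !ffunE. Qed.

HB.instance Definition _ t := GRing.isLinear.Build F M F *%R (tcoef t) (tcoef_linear t).

Lemma tcoefP (v w : M) : (forall t, tcoef t v = tcoef t w) -> v = w.
Proof. by move=> e; apply/ffunP => t; exact: e. Qed.

Lemma tabloid_mod_sum v : v = \sum_t tcoef t v *: vec t.
Proof.
apply: tcoefP => u; rewrite linear_sum (bigD1 u) //= big1 ?addr0.
  by rewrite linearZ /= tcoef_vec eqxx mulr1.
by move=> t ne_t; rewrite linearZ /= tcoef_vec eq_sym (negPf ne_t) mulr0.
Qed.

Lemma eq_tabloid_lfun (W : vectType F) (f g : 'Hom(M, W)) :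
  (forall t, f (vec t) = g (vec t)) -> f = g.
Proof.
move=> e; apply/lfunP => v; rewrite [v]tabloid_mod_sum !linear_sum.
by apply: eq_bigr => t _; rewrite !linearZ /= e.
Qed.

Lemma lfun_vec (W : vectType F) (f : 'Hom(M, W)) v : f v = \sum_t tcoef t v *: f (vec t).
Proof.
rewrite {1}[v]tabloid_mod_sum (linear_sum f); apply: eq_bigr => t _; exact: linearZ.
Qed.

Section Lift.
Variables (W : vectType F) (g : tabloid n la -> W).

Let lift v : W := \sum_t tcoef t v *: g t.
Let lift_linear : linear lift.
Proof.
move=> a u v; rewrite /lift scaler_sumr -big_split; apply: eq_bigr => t _ /=.
by rewrite linearP /= scalerDl scalerA.
Qed.
HB.instance Definition _ := GRing.isLinear.Build F M W *:%R lift lift_linear.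

Definition tlin : 'Hom(M, W) := locked (linfun lift).

Lemma tlinE v : tlin v = \sum_t tcoef t v *: g t.
Proof. by rewrite /tlin -lock lfunE. Qed.

Lemma tlin_vec t : tlin (vec t) = g t.
Proof.
rewrite tlinE (bigD1 t) //= tcoef_vec eqxx scale1r big1 ?addr0 // => u ne_u.
by rewrite tcoef_vec (negPf ne_u) scale0r.
Qed.

End Lift.

Lemma mem_span_vec (s : seq (tabloid n la)) v t :
  v \in <<[seq vec u | u <- s]>>%VS -> t \notin s -> tcoef t v = 0.
Proof.
move=> vs ts; pose f : 'Hom(M, F^o) := linfun (tcoef t : M -> F^o).
have fE w : f w = tcoef t w by rewrite lfunE.
suff /subvP/(_ _ vs): (<<[seq vec u | u <- s]>> <= lker f)%VS by rewrite memv_ker fE => /eqP.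
apply/span_subvP => _ /mapP[u us ->]; rewrite memv_ker fE tcoef_vec.
have [et|_] := eqVneq t u; last exact: eqxx.
by rewrite et us in ts.
Qed.

Lemma free_vec (s : seq (tabloid n la)) : uniq s -> free [seq vec u | u <- s].
Proof.
elim: s => [|t s IH] /=; first by rewrite nil_free.
case/andP=> ts /IH fs; rewrite free_cons fs andbT; apply/negP => /mem_span_vec/(_ ts)/eqP.
by rewrite tcoef_vec eqxx oner_eq0.
Qed.

Lemma dim_tabloid_mod : \dim (fullv : {vspace M}) = #|{: tabloid n la}|.
Proof.
pose ts := enum {: tabloid n la}; have fr := free_vec (enum_uniq {: tabloid n la}).
suff -> : (fullv : {vspace M}) = <<[seq vec u | u <- ts]>>%VS.
  by rewrite (eqnP fr) size_map -cardE.
apply/esym/vspaceP => v; rewrite memvf [v]tabloid_mod_sum; apply: memv_suml => t _.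
by apply/memvZ/memv_span/map_f; rewrite mem_enum.
Qed.

End TabloidModule.

(* Sealed, because unifying two instances of [tabloid_rho] unfolds them. *)
HB.lock Definition trho n la F (s : 'S_n) : 'End(tabloid_mod n la F) := tabloid_rho la F s.

Lemma trho_vec n la F (s : 'S_n) t :
  trho la F s (tabloid_vec F t) = tabloid_vec F (tabloid_act s t).
Proof. by rewrite trho.unlock tabloid_rho_vec. Qed.

(** * Coefficients of the fundamental quasisymmetric functions *)

Lemma cell_row_adjacent be (i : nat) : (i.+1 < sumn be)%N ->
  (cell_row be i <= cell_row be i.+1)%N /\
  (cell_row be i = cell_row be i.+1 -> cell_col be i.+1 = (cell_col be i).+1).
Proof.
move=> lt_i; have := reshape_leq be i i.+1; rewrite leqnSn -/(cell_row _ _) -/(cell_row _ _).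
move=> /esym/orP le_row; split.
  by case: le_row => [/ltnW//|/andP[/eqP -> _]].
rewrite /cell_row /cell_col /reshape_offset => <-; rewrite subSn //.
by have := reshape_indexK be i; rewrite /flatten_index; lia.
Qed.

Lemma blocks_sortedP be w : size w = sumn be ->
  reflect (forall i, (i.+1 < size w)%N -> cell_row be i = cell_row be i.+1 ->
             (nth 0 w i <= nth 0 w i.+1)%N) (blocks_sorted be w).
Proof.
move=> szw; apply: (iffP allP) => [so i lt_i eq_r|H s].
  have lt_i' : (i.+1 < sumn be)%N by rewrite -szw.
  have [_ /(_ eq_r) eq_c] := cell_row_adjacent lt_i'.
  have offi := reshape_offsetP (ltnW lt_i'); have offi' := reshape_offsetP lt_i'.
  rewrite -[in nth _ _ i](reshape_indexK be i) -[in nth _ _ i.+1](reshape_indexK be i.+1).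
  rewrite -!nth_frow //; rewrite /cell_row /cell_col in eq_r eq_c.
  rewrite eq_c -eq_r; apply/(sortedP 0) => //.
    apply: so; rewrite /frow mem_nth // size_reshape; apply: reshape_indexP; exact: ltnW.
  by rewrite size_frow // -eq_c eq_r.
move=> /(nthP [::])[r lt_r <-]; rewrite -/(frow be w r); apply/(sortedP 0) => c.
rewrite size_frow // => lt_c; have lt_c' := ltnW lt_c.
rewrite !nth_frow // /flatten_index addnS; apply: H.
  by rewrite szw -addnS; exact: (flatten_indexP lt_c).
by rewrite -addnS /cell_row !(flatten_indexKl lt_c, flatten_indexKl lt_c').
Qed.

(** The only weakly increasing word of content [al] is [cword al], so the coefficient is 0 or 1; in
    degree n it is 1 when each element of I separates two blocks of equal letters. *)
Lemma fundamental_cmset n (I : {set 'I_n.-1}) al :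
  fundamental I (cmset al) = ((sumn al == n) &&
    [forall j in I, (cell_row (rev al) j < cell_row (rev al) j.+1)%N])%:R.
Proof.
rewrite /fundamental word_sum_seq_mset; congr (_%:R).
set C := (X in nat_of_bool X).
have eqC : (sumn al == n) &&
    [forall j in I, (nth 0 (cword al) (j : nat) < nth 0 (cword al) j.+1)%N] = C.
  rewrite /C; case: eqP => //= sum_al; apply: eq_forallb => j; congr (_ ==> _).
  rewrite -[in cword al](revK al) -mkseq_cell_row sumn_rev sum_al.
  by rewrite !nth_mkseq //; have := ltn_ord j; lia.
transitivity (count (fun w => C && (w == cword al)) (permutations (cword al))).
  apply: eq_in_count => w; rewrite mem_permutations => pw /=.
  apply/and3P/andP => [[/eqP sz so dI]|[c /eqP ->]].
    have ew : w = cword al by apply: (sorted_eq leq_trans anti_leq so (sorted_cword al) pw).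
    have sum_al : sumn al = n by rewrite -sz (perm_size pw) size_cword.
    by rewrite -eqC sum_al eqxx -ew dI.
  by move: c; rewrite -eqC => /andP[sz dI]; rewrite size_cword sz sorted_cword.
case: (C) => /=; last by rewrite count_pred0.
by rewrite count_uniq_mem ?permutations_uniq // mem_permutations perm_refl.
Qed.

(** * The 0-Hecke action on tabloids *)

(* The relations are checked on an abstract basis [vec]: in the tabloid module
   itself, unification would unfold the vectors. *)
Section SortingAbstract.
Variables (n : nat) (T : Type) (W : zmodType).
Variables (row : T -> 'I_n -> nat) (swap : 'I_n -> 'I_n -> T -> T).
Variables (vec : T -> W) (op : 'I_n -> 'I_n -> W -> W).
Hypothesis row_inj : forall t u, row t =1 row u -> t = u.
Hypothesis row_swap : forall x y t i, row (swap x y t) i = row t (tperm x y i).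
Hypothesis op_vec : forall x y t, op x y (vec t) =
  if (row t x < row t y)%N then vec (swap x y t)
  else if (row t y < row t x)%N then - vec t else 0.
Hypothesis opN : forall x y v, op x y (- v) = - op x y v.
Hypothesis op0 : forall x y, op x y 0 = 0.
Implicit Types (t u : T) (x y z : 'I_n).

Let opE := (op_vec, opN, op0, row_swap, tpermL, tpermR, @opprK W, @oppr0 W).

Lemma op_quad x y t : op x y (op x y (vec t)) = - op x y (vec t).
Proof.
by case E1: (row t x < row t y)%N; case E2: (row t y < row t x)%N; try lia;
  rewrite !(opE, E1, E2).
Qed.

Lemma op_comm x y z w t : uniq [:: x; y; z; w] ->
  op x y (op z w (vec t)) = op z w (op x y (vec t)).
Proof.
move=> U; have D :
  ((tperm x y z = z) * (tperm x y w = w) * (tperm z w x = x) * (tperm z w y = y))%type.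
  move: U; rewrite /= !inE !negb_or => /and4P[/and3P[? ? ?] /andP[? ?] ? _].
  by do !split; apply: tpermD; rewrite // eq_sym.
have sC : swap x y (swap z w t) = swap z w (swap x y t).
  apply: row_inj => i; rewrite !row_swap; congr row.
  have [->|nx] := eqVneq i x; first by rewrite !(D, tpermL).
  have [->|ny] := eqVneq i y; first by rewrite !(D, tpermR).
  have [->|nz] := eqVneq i z; first by rewrite !(D, tpermL).
  have [->|nw] := eqVneq i w; first by rewrite !(D, tpermR).
  by rewrite !tpermD // eq_sym.
by case E1: (row t x < row t y)%N; case E2: (row t y < row t x)%N;
  case E3: (row t z < row t w)%N; case E4: (row t w < row t z)%N; try lia;
  rewrite !(opE, D, E1, E2, E3, E4, sC).
Qed.

(** Only the relative order of the three rows matters. When they strictly increase, each side swaps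
    three times, and [br], the braid relation of transpositions, identifies the results. *)
Lemma op_braid x y z t : uniq [:: x; y; z] ->
  op x y (op y z (op x y (vec t))) = op y z (op x y (op y z (vec t))).
Proof.
move=> U; have D : ((tperm x y z = z) * (tperm y z x = x))%type.
  move: U; rewrite /= !inE !negb_or => /and3P[/andP[? ?] ? _].
  by split; apply: tpermD; rewrite // eq_sym.
have br : swap x y (swap y z (swap x y t)) = swap y z (swap x y (swap y z t)).
  apply: row_inj => i; rewrite !row_swap; congr row.
  have [->|nx] := eqVneq i x; first by rewrite !(D, tpermL, tpermR).
  have [->|ny] := eqVneq i y; first by rewrite !(D, tpermL, tpermR).
  have [->|nz] := eqVneq i z; first by rewrite !(D, tpermL, tpermR).
  by rewrite !tpermD // eq_sym.
by case E1: (row t x < row t y)%N; case E2: (row t y < row t x)%N;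
  case E3: (row t y < row t z)%N; case E4: (row t z < row t y)%N;
  case E5: (row t x < row t z)%N; case E6: (row t z < row t x)%N; try lia;
  rewrite !(opE, D, E1, E2, E3, E4, E5, E6, br).
Qed.

End SortingAbstract.

Fact ltn_pred_l n (j : 'I_n.-1) : (j < n)%N.
Proof. by have := ltn_ord j; lia. Qed.
Fact ltn_pred_r n (j : 'I_n.-1) : (j.+1 < n)%N.
Proof. by have := ltn_ord j; lia. Qed.

Definition letl n (j : 'I_n.-1) := Ordinal (ltn_pred_l j).
Definition letr n (j : 'I_n.-1) := Ordinal (ltn_pred_r j).

Section Sorting.
Variables (F : fieldType) (n : nat) (la : seq nat).
Hypothesis sum_la : sumn la = n.
Local Notation M := (tabloid_mod n la F).
Local Notation vec := (@tabloid_vec n la F).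
Implicit Types (t u : tabloid n la) (x y z : 'I_n).

Definition swap x y t := tabloid_act (tperm x y) t.

Lemma trow_swap x y t i : trow (swap x y t) i = trow t (tperm x y i).
Proof. by rewrite /swap trow_act // tpermV. Qed.

Definition sort_op x y : 'End(M) := tlin (fun t =>
  if (trow t x < trow t y)%N then vec (swap x y t)
  else if (trow t y < trow t x)%N then - vec t else 0).

Let sort_opE x y t : sort_op x y (vec t) =
  if (trow t x < trow t y)%N then vec (swap x y t)
  else if (trow t y < trow t x)%N then - vec t else 0.
Proof. exact: tlin_vec. Qed.

Let sort_opN x y (v : M) : sort_op x y (- v) = - sort_op x y v.
Proof. exact: linearN. Qed.

Let sort_op0 x y : sort_op x y 0 = 0.
Proof. exact: linear0. Qed.

Lemma sort_op_quad x y : (sort_op x y \o sort_op x y)%VF = - sort_op x y.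
Proof.
apply: eq_tabloid_lfun => t; rewrite comp_lfunE opp_lfunE.
exact: (op_quad trow_swap sort_opE sort_opN sort_op0).
Qed.

Lemma sort_op_comm x y z w : uniq [:: x; y; z; w] ->
  (sort_op x y \o sort_op z w)%VF = (sort_op z w \o sort_op x y)%VF.
Proof.
move=> U; apply: eq_tabloid_lfun => t; rewrite !comp_lfunE.
exact: (op_comm (trow_inj sum_la) trow_swap sort_opE sort_opN sort_op0).
Qed.

Lemma sort_op_braid x y z : uniq [:: x; y; z] ->
  (sort_op x y \o sort_op y z \o sort_op x y)%VF
  = (sort_op y z \o sort_op x y \o sort_op y z)%VF.
Proof.
move=> U; apply: eq_tabloid_lfun => t; rewrite !comp_lfunE.
exact: (op_braid (trow_inj sum_la) trow_swap sort_opE sort_opN sort_op0).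
Qed.

Definition hecke_op (j : 'I_n.-1) : 'End(M) := sort_op (letl j) (letr j).

Lemma hecke_op_module : hecke0_module hecke_op.
Proof.
split=> [i|i j lt_ij|i j eq_ij]; first exact: sort_op_quad.
  apply: sort_op_comm; rewrite /= !inE -!val_eqE /=; lia.
have e : letl j = letr i by apply: val_inj.
by rewrite /hecke_op e; apply: sort_op_braid; rewrite /= !inE -!val_eqE /=; lia.
Qed.

Definition descents t : {set 'I_n.-1} := [set j | (trow t (letr j) < trow t (letl j))%N].

Definition potential t : nat := \sum_(i < n) i * trow t i.

Lemma potential_swap (j : 'I_n.-1) t : (trow t (letl j) < trow t (letr j))%N ->
  (potential (swap (letl j) (letr j) t) < potential t)%N.
Proof.
move=> lt_j; have ne_j : letr j != letl j by rewrite -val_eqE /=; lia.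
have split_pot u : potential u = (j * trow u (letl j) + (j.+1 * trow u (letr j)
    + \sum_(i < n | (i != letl j) && (i != letr j)) i * trow u i))%N.
  by rewrite /potential (bigD1 (letl j)) // (bigD1 (letr j)).
rewrite !split_pot !trow_swap tpermL tpermR.
rewrite (eq_bigr (fun i : 'I_n => i * trow t i)%N) => [|i /andP[nl nr]].
  by rewrite !mulSn; move: (bigop _ _ _) => S0; lia.
by rewrite trow_swap tpermD // eq_sym.
Qed.

Definition tab_list : seq (tabloid n la) :=
  sort (fun t u => potential t <= potential u)%N (enum {: tabloid n la}).

Lemma mem_tab_list t : t \in tab_list.
Proof. by rewrite mem_sort mem_enum. Qed.

Lemma uniq_tab_list : uniq tab_list.
Proof. by rewrite sort_uniq enum_uniq. Qed.

(** Tabloids of equal potential come in arbitrary order, hence the strict inequality;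
    [potential_swap] provides it. *)
Lemma take_tab_list k t u : t \in take k tab_list ->
  (potential u < potential t)%N -> u \in take k tab_list.
Proof.
have tr : transitive (fun t u => potential t <= potential u)%N.
  by move=> x y z; apply: leq_trans.
have : sorted (fun t u => potential t <= potential u)%N tab_list.
  by apply: sort_sorted => x y; apply: leq_total.
rewrite (sorted_pairwise tr) -{1}(cat_take_drop k tab_list) pairwise_cat.
case/andP=> /allrelP H _ tk lt_ut; have := mem_tab_list u.
rewrite -{1}(cat_take_drop k tab_list) mem_cat => /orP[//|/(H _ _ tk)].
by rewrite leqNgt lt_ut.
Qed.

Definition tab_filt k : {vspace M} := <<[seq vec t | t <- take k tab_list]>>%VS.

Lemma vec_tab_filt k t : t \in take k tab_list -> vec t \in tab_filt k.
Proof. by move=> tk; apply/memv_span/map_f. Qed.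

Lemma tab_filt_stable k : hecke0_stable hecke_op (tab_filt k).
Proof.
move=> j; rewrite limg_span; apply/span_subvP => _ /mapP[_ /mapP[t tk ->] ->].
rewrite sort_opE; case: ifP => [lt_j|_]; last first.
  by case: ifP => _; rewrite ?mem0v // memvN vec_tab_filt.
exact/vec_tab_filt/(take_tab_list tk)/potential_swap.
Qed.

Lemma tab_filt_factor t0 k : (k < size tab_list)%N ->
  factor_is hecke_op (tab_filt k) (tab_filt k.+1) (descents (nth t0 tab_list k)).
Proof.
move=> lt_k; set t := nth t0 tab_list k.
have tk : take k.+1 tab_list = rcons (take k tab_list) t by rewrite (take_nth t0).
have dimk m : (m <= size tab_list)%N -> \dim (tab_filt m) = m.
  move=> le_m; have /eqnP -> := free_vec F (take_uniq m uniq_tab_list).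
  by rewrite size_map size_takel.
have sub : (tab_filt k <= tab_filt k.+1)%VS.
  by apply/span_subvP => _ /mapP[u uk ->]; apply: vec_tab_filt; rewrite tk mem_rcons inE uk orbT.
split=> // [|j v]; first by rewrite !dimk // ltnW.
(* [q] is the generator minus the scalar by which it acts on C_I. That it maps W into U is an
   inclusion of W in a preimage, hence can be checked on the spanning tabloids. *)
pose q : 'End(M) := hecke_op j - (if j \in descents t then - \1%VF else 0).
have qE w : q w = hecke_op j w - (if j \in descents t then - w else 0).
  rewrite /q add_lfunE opp_lfunE; case: ifP => _; last by rewrite zero_lfunE.
  by rewrite opp_lfunE id_lfunE.
move=> vW; rewrite -qE memv_preim; apply: (subvP _ _ vW).
apply/span_subvP => _ /mapP[u uk ->]; rewrite -memv_preim qE.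
move: uk; rewrite tk mem_rcons inE => /predU1P[->|uk]; last first.
  rewrite memvB //; first by apply: (subvP (tab_filt_stable k j)); rewrite memv_img ?vec_tab_filt.
  by case: ifP => _; rewrite ?mem0v // memvN vec_tab_filt.
rewrite inE sort_opE; case: (ltngtP (trow t (letl j)) (trow t (letr j))) => [lt_j|_|_].
- have st := potential_swap lt_j; rewrite subr0; apply: vec_tab_filt.
  have : swap (letl j) (letr j) t \in take k.+1 tab_list.
    by apply: take_tab_list st; rewrite tk mem_rcons mem_head.
  rewrite tk mem_rcons inE => /predU1P[e|//].
  by move: st; rewrite e ltnn.
- by rewrite subrr mem0v.
- by rewrite subrr mem0v.
Qed.

(** Cutting the word of t into blocks gives tables whose rows are the blocks and whose columns are
    the rows of la; [ntable_sym] transposes them. *)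
Lemma card_weak_tabloids al : sumn al = n ->
  #|[pred t : tabloid n la | blocks_sorted (rev al) (tword t)]| = ntable la al.
Proof.
move=> sum_al; rewrite -count_tword // count_blocks_sorted ?sumn_rev ?sum_al //.
by rewrite ntable_rev (@ntable_sym n) ?sumn_rev ?sum_al ?sum_la // ntable_rev.
Qed.

Lemma sum_fundamental al :
  \sum_(t : tabloid n la) fundamental (descents t) (cmset al) = (ntable la al)%:R.
Proof.
under eq_bigr => t _ do rewrite fundamental_cmset.
have [sum_al|ne_al] := eqVneq (sumn al) n; last first.
  (* In a degree other than n, no shape ends chains of both contents. *)
  rewrite big1 // (@ntable_nchain n) ?sum_la // /dot big1 // => rho _.
  apply/eqP; rewrite muln_eq0; apply: contraR ne_al; rewrite negb_or => /andP[n1 n2].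
  by rewrite -(nchain_supp n2) (nchain_supp n1) sum_la.
rewrite -(card_weak_tabloids sum_al) -sum1_card natr_sum [RHS]big_mkcond /=.
apply: eq_bigr => t _; rewrite inE /=.
have szt : size (tword t) = sumn (rev al) by rewrite size_tword sumn_rev.
set b := (X in nat_of_bool X); suff -> : b = blocks_sorted (rev al) (tword t) by case: ifP.
apply/forallP/(blocks_sortedP szt) => [H i lt_i eq_r|H j].
  rewrite size_tword in lt_i; have lt_j : (i < n.-1)%N by lia.
  have := H (Ordinal lt_j); rewrite inE /= eq_r ltnn implybF -leqNgt.
  by rewrite -!nth_tword.
apply/implyP; rewrite inE; apply: contraTT; rewrite -!leqNgt => le_r.
have := ltn_pred_r j => lt_j; rewrite -!nth_tword /=; apply: H; first by rewrite size_tword.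
apply/eqP; rewrite eqn_leq le_r andbT.
by have [] := @cell_row_adjacent (rev al) j; rewrite ?sumn_rev ?sum_al.
Qed.

Lemma hecke_op_FQchar : FQchar_is hecke_op (complete_sym_part la).
Proof.
have sz : size [seq descents t | t <- tab_list] = size tab_list by rewrite size_map.
exists [seq descents t | t <- tab_list], tab_filt; split.
- by rewrite /tab_filt take0 span_nil.
- rewrite sz /tab_filt take_size; apply/vspaceP => v; rewrite memvf [v]tabloid_mod_sum.
  apply: memv_suml => t _; apply/memvZ/memv_span/map_f; exact: mem_tab_list.
- by move=> k _; apply: tab_filt_stable.
- move=> k; rewrite sz => lt_k; rewrite (nth_map (tabloid_of la 1%g)) //.
  exact: tab_filt_factor.
move=> m; have [al ->] := cmsetP m; rewrite complete_sym_partE -sum_fundamental big_map.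
by rewrite [RHS](perm_big (enum {: tabloid n la})) ?perm_sort // big_enum.
Qed.

End Sorting.

(** * Specht modules and Young's rule *)

(** Among the indices with nonzero c take j with w j least: only the diagonal term survives in
    equation j. *)
Lemma triangular_indep (F : fieldType) (I : finType) (P : pred I)
    (m : I -> I -> F) (w : I -> nat) (c : I -> F) :
  (forall j, P j -> \sum_(i | P i) c i * m i j = 0) ->
  (forall i j, P i -> P j -> m i j != 0 -> (w i < w j)%N \/ i = j) ->
  (forall i, P i -> m i i != 0) ->
  forall i, P i -> c i = 0.
Proof.
move=> sum0 tri diag i Pi; apply/eqP; apply: contraT => nz_i.
case: (@arg_minnP _ i (fun j => P j && (c j != 0)) w) => [|j /andP[Pj nz_j] min_j].
  by rewrite Pi.
have := sum0 j Pj; rewrite (bigD1 j) //= big1 ?addr0 => [/eqP|k /andP[Pk ne_kj]].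
  by rewrite mulf_eq0 (negPf nz_j) (negPf (diag j Pj)).
have [->|nz_k] := eqVneq (c k) 0; first by rewrite mul0r.
have [->|/(tri _ _ Pk Pj)[lt_kj|e]] := eqVneq (m k j) 0; first by rewrite mulr0.
  by have := min_j k; rewrite Pk nz_k leqNgt lt_kj => /(_ isT).
by rewrite e eqxx in ne_kj.
Qed.

Section Specht.
Variables (F : fieldType) (n : nat).
Hypothesis char0 : [pchar F] =i pred0.
Implicit Types (la mu : seq nat) (s : 'S_n).

Local Notation Mod la := (tabloid_mod n la F).
Local Notation vec la := (@tabloid_vec n la F).
Local Notation rho la := (@trho n la F).
Local Notation t1 mu := (tabloid_of mu (1%g : 'S_n)).
Local Notation sgn s := ((-1) ^+ odd_perm s : F).

Lemma tcoefZ la (t : tabloid n la) a (v : Mod la) : tcoef t (a *: v) = a * tcoef t v.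
Proof. exact: linearZ. Qed.

Lemma tcoef_sum la (t : tabloid n la) (I : finType) (P : pred I) (f : I -> Mod la) :
  tcoef t (\sum_(i | P i) f i) = \sum_(i | P i) tcoef t (f i).
Proof. exact: linear_sum. Qed.

Definition col_antisym mu la : 'End(Mod la) :=
  \sum_(s | colperm mu s) sgn s *: rho la s.

(** The polytabloid of the identity filling, which has letter c in cell c; by [polytabloidE] its
    translates are all the polytabloids. *)
Definition spoly mu : Mod mu := \sum_(s | colperm mu s) sgn s *: vec mu (tabloid_act s (t1 mu)).

Lemma col_antisymE mu la v : col_antisym mu la v = \sum_(s | colperm mu s) sgn s *: rho la s v.
Proof. by rewrite sum_lfunE; apply: eq_bigr => s _; rewrite scale_lfunE. Qed.

Lemma col_antisym_vec mu la t : col_antisym mu la (vec la t)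
  = \sum_(s | colperm mu s) sgn s *: vec la (tabloid_act s t).
Proof. by rewrite col_antisymE; apply: eq_bigr => s _; rewrite trho_vec. Qed.

Lemma col_antisym_spoly mu : col_antisym mu mu (vec mu (t1 mu)) = spoly mu.
Proof. exact: col_antisym_vec. Qed.

Lemma sgnM s s' : sgn (s * s')%g = sgn s * sgn s'.
Proof. by rewrite odd_permM signr_addb. Qed.

Section OneShape.
Variables (mu : seq nat).
Hypotheses (sum_mu : sumn mu = n) (decr_mu : forall r, (nth 0 mu r.+1 <= nth 0 mu r)%N).

(** Conjugation by T carries the column permutations of the cells to the column stabilizer of T. *)
Lemma polytabloidE (T : 'S_n) : polytabloid mu F T = rho mu T (spoly mu).
Proof.
rewrite /polytabloid /spoly linear_sum /=.
rewrite (reindex_inj (conjg_inj T)) /=; apply: eq_big => [s|s _].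
  rewrite inE; apply/forallP/forallP => H c.
    by have := H c; rewrite conjgE !permM permK permK.
  by have := H c; rewrite conjgE !permM permK permK.
rewrite linearZ /= trho_vec odd_permJ tabloid_actM !tabloid_act_of.
by congr (_ *: vec _ (tabloid_of _ _)); rewrite mul1g conjgE mulKVg.
Qed.

Lemma spoly_specht s : rho mu s (spoly mu) \in specht n mu F.
Proof. by rewrite -polytabloidE; apply/memv_span/map_f; rewrite mem_enum. Qed.

Lemma specht_ind (W : {vspace Mod mu}) :
  (forall s, rho mu s (spoly mu) \in W) -> (specht n mu F <= W)%VS.
Proof. by move=> H; apply/span_subvP => _ /mapP[T _ ->]; rewrite polytabloidE. Qed.

(** The invariant bilinear form for which the tabloids are orthonormal; conjugation enters only
    where positivity is wanted. *)
Definition tdot (w v : Mod mu) : F := \sum_t tcoef t v * tcoef t w.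

Fact tdot_linear w : linear_for *%R (tdot w).
Proof.
move=> a u v; rewrite /tdot mulr_sumr -big_split; apply: eq_bigr => t _ /=.
by rewrite linearP /= mulrDl mulrA.
Qed.
HB.instance Definition _ w := GRing.isLinear.Build F (Mod mu) F *%R (tdot w) (tdot_linear w).

Lemma tdotC v w : tdot v w = tdot w v.
Proof. by apply: eq_bigr => t _; rewrite mulrC. Qed.

Lemma tcoef_rho s v t : tcoef t (rho mu s v) = tcoef (tabloid_act s^-1%g t) v.
Proof.
rewrite (lfun_vec (rho mu s) v) tcoef_sum [in RHS](tabloid_mod_sum v) tcoef_sum.
apply: eq_bigr => u _; rewrite !tcoefZ trho_vec !tcoef_vec; congr (_ * _%:R).
congr nat_of_bool; apply/eqP/eqP => [->|<-].
  by rewrite tabloid_actM mulgV tabloid_act1.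
by rewrite tabloid_actM mulVg tabloid_act1.
Qed.

Lemma tdot_rho s v w : tdot w (rho mu s v) = tdot (rho mu s^-1%g w) v.
Proof.
have inj : injective (@tabloid_act n mu s).
  move=> t u /(congr1 (@tabloid_act n mu s^-1%g)).
  by rewrite !tabloid_actM mulgV !tabloid_act1.
rewrite /tdot (reindex_inj inj) /=; apply: eq_bigr => t _.
by rewrite !tcoef_rho invgK tabloid_actM mulgV tabloid_act1.
Qed.

(** The tabloid fixes the row of each letter and the column permutation its column, hence its cell:
    the tabloids in [spoly] are distinct. *)
Lemma colperm_row_inj s s' : colperm mu s -> colperm mu s' ->
  tabloid_act s (t1 mu) = tabloid_act s' (t1 mu) -> s = s'.
Proof.
move=> cs cs' e; apply: invg_inj; apply/permP => i.
apply: (cell_inj (mu := mu)).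
  have := congr1 (fun t => trow t i) e.
  by rewrite !trow_act // !trow_of // invg1 !perm1.
by rewrite !(eqP (forallP (colpermV _) i)).
Qed.

Lemma tcoef_spoly t : tcoef t (spoly mu)
  = \sum_(s | colperm mu s) sgn s * (t == tabloid_act s (t1 mu))%:R.
Proof.
rewrite /spoly tcoef_sum.
apply: eq_bigr => s _.
transitivity (sgn s * tcoef t (vec mu (tabloid_act s (t1 mu)))).
2: by rewrite tcoef_vec.
exact: tcoefZ.
Qed.

Lemma tcoef_spoly_act s : colperm mu s -> tcoef (tabloid_act s (t1 mu)) (spoly mu) = sgn s.
Proof.
move=> cs; rewrite tcoef_spoly (bigD1 s cs) /= eqxx mulr1 big1 ?addr0 // => s' /andP[cs' ne_s].
case: eqP => [/colperm_row_inj e|_]; last by rewrite mulr0.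
by rewrite e ?eqxx in ne_s.
Qed.

Section Antisym.
Variable la : seq nat.
Hypothesis sum_la : sumn la = n.
Implicit Types t : tabloid n la.

Lemma col_antisym_act s t : colperm mu s ->
  col_antisym mu la (vec la (tabloid_act s t)) = sgn s *: col_antisym mu la (vec la t).
Proof.
move=> cs; rewrite [LHS]col_antisym_vec (col_antisym_vec mu t) (scaler_sumr (sgn s)).
rewrite [RHS](reindex_inj (mulgI s)) /=; apply: eq_big => [s'|s' _].
  apply/idP/idP => [|cs']; first exact: colpermM.
  by rewrite -[s'](mulKg s); apply: colpermM => //; apply: colpermV.
by rewrite tabloid_actM scalerA sgnM mulrA -signr_addb addbb mul1r.
Qed.

(** The transposition of c and d fixes t but changes the sign of its antisymmetrization, so twice
    the latter is 0. *)
Lemma col_antisym_repeat t (c d : 'I_n) : c != d -> cell_col mu c = cell_col mu d ->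
  trow t c = trow t d -> col_antisym mu la (vec la t) = 0.
Proof.
move=> ne_cd ec er; have fix_t : tabloid_act (tperm c d) t = t.
  apply: trow_inj => // i; rewrite trow_act // tpermV.
  by case: tpermP => [->|->|].
have := col_antisym_act t (colperm_tperm ec); rewrite fix_t odd_tperm ne_cd expr1 scaleN1r.
move/eqP; rewrite -addr_eq0 -mulr2n -scaler_nat scaler_eq0 => /orP[|/eqP //].
by have /pcharf0P -> := char0.
Qed.

(* If [t] survives column antisymmetrization for [mu], its entries can be sorted
   to dominate the row indices of [mu] cell by cell. *)
Lemma col_antisym_sort t : col_antisym mu la (vec la t) != 0 ->
  exists2 s, colperm mu s & forall c : 'I_n, (cell_row mu c <= trow t (s c))%N.
Proof.
move=> nz; apply: (sort_columns_ge sum_mu decr_mu) => c d ec er; apply/eqP.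
by apply: contraNT nz => ne_cd; apply/eqP/(col_antisym_repeat ne_cd).
Qed.

Lemma sum_trow t : (\sum_c trow t c = \sum_(c < n) cell_row la c)%N.
Proof.
have [T ->] := tabloidP t; rewrite -(sum_perm (fun c : 'I_n => cell_row la c) T^-1%g).
by apply: eq_bigr => c _; rewrite trow_of.
Qed.

(** The total of [trow t] over all letters is that of the rows of the cells of la, so the cellwise
    bound of [col_antisym_sort] compares totals, and is an equality throughout when they agree. *)
Lemma col_antisym_sum_row t : col_antisym mu la (vec la t) != 0 ->
  (\sum_(c < n) cell_row mu c <= \sum_(c < n) cell_row la c)%N /\
  ((\sum_(c < n) cell_row la c <= \sum_(c < n) cell_row mu c)%N ->
     exists2 s, colperm mu s & forall c : 'I_n, trow t (s c) = cell_row mu c).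
Proof.
move=> /col_antisym_sort[s cs le_s]; rewrite -(sum_trow t) -(sum_perm (trow t) s).
split=> [|le_sum]; first by apply: leq_sum.
by exists s => // c; apply/esym/(leq_sum_eq le_s le_sum).
Qed.

Lemma perm_cell_row t s : (forall c : 'I_n, trow t (s c) = cell_row mu c) ->
  perm_eq (cword (rev mu)) (cword (rev la)).
Proof.
move=> e; rewrite -(map_cell_row sum_mu).
have [u ut] : exists u : tabloid n la, trow u =1 (fun c : 'I_n => cell_row mu c).
  by exists (tabloid_act s^-1%g t) => c; rewrite trow_act // invgK.
by rewrite -(eq_map ut); apply: perm_tword.
Qed.

End Antisym.

(** A tabloid of shape mu that survives is a column translate of the identity tabloid, by the
    equality case of [col_antisym_sum_row], and contributes its sign in [spoly]; the others have
    coefficient 0 there. *)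
Lemma col_antisym_spolyE (y : Mod mu) : col_antisym mu mu y = tdot (spoly mu) y *: spoly mu.
Proof.
rewrite lfun_vec /tdot scaler_suml; apply: eq_bigr => t _; rewrite -scalerA; congr (_ *: _).
have act_case s : colperm mu s -> t = tabloid_act s (t1 mu) ->
    col_antisym mu mu (vec mu t) = tcoef t (spoly mu) *: spoly mu.
  by move=> cs ->; rewrite col_antisym_act // tcoef_spoly_act // col_antisym_spoly.
have [k0|nz] := eqVneq (col_antisym mu mu (vec mu t)) 0; last first.
  have [_ /(_ (leqnn _)) [s cs e]] := col_antisym_sum_row sum_mu nz.
  apply: (act_case s) => //; apply: trow_inj => // i.
  by rewrite trow_act // trow_of // invg1 perm1 -e permKV.
rewrite k0; case: (pickP (fun s => colperm mu s && (t == tabloid_act s (t1 mu)))).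
  by move=> s /andP[cs /eqP /(act_case s cs)]; rewrite k0.
move=> no_s; rewrite tcoef_spoly big1 ?scale0r // => s cs.
by have := no_s s; rewrite cs /= => ->; rewrite mulr0.
Qed.

End OneShape.

(** When the head is nonzero, the largest letter of [cword al] is [size al] minus 1, so the word
    determines the length of the list. *)
Lemma cword_part_inj (al be : seq nat) : 0%N \notin al -> 0%N \notin be ->
  perm_eq (cword al) (cword be) -> al = be.
Proof.
have size_le (a b : seq nat) : 0%N \notin a -> perm_eq (cword a) (cword b) ->
    (size a <= size b)%N.
  case: a => [|x a] //; rewrite inE negb_or eq_sym => /andP[nz_x _] /perm_mem pe.
  apply: (allP (cword_lt b)); rewrite -pe /= mem_cat mem_nseq eqxx andbT lt0n.
  by rewrite nz_x orbT.
move=> pa pb pe; apply: cword_inj => //; apply/eqP; rewrite eqn_leq (size_le al) //.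
by rewrite (size_le be) // perm_sym.
Qed.

Lemma is_part_decr mu : is_part n mu -> forall r, (nth 0 mu r.+1 <= nth 0 mu r)%N.
Proof.
case/and3P=> so _ _ r; have [lt_r|le_r] := ltnP r.+1 (size mu); last by rewrite nth_default.
exact: (sortedP 0 so).
Qed.

Lemma is_part_sum mu : is_part n mu -> sumn mu = n.
Proof. by case/and3P=> _ _ /eqP. Qed.

(** For la of size n, the statistic n(la), the sum of i la_i with rows numbered from 0. *)
Definition row_sum (la : seq nat) : nat := \sum_(c < n) cell_row la c.

Lemma col_antisym_eq0 mu la (y : Mod la) : is_part n mu -> is_part n la ->
  (row_sum la <= row_sum mu)%N -> mu != la -> col_antisym mu la y = 0.
Proof.
move=> pmu pla le_sum ne; have sum_la := is_part_sum pla; have sum_mu := is_part_sum pmu.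
rewrite lfun_vec big1 // => t _.
have [->|nz] := eqVneq (col_antisym mu la (vec la t)) 0; first by rewrite scaler0.
have [_ /(_ le_sum)[s _ e]] := col_antisym_sum_row sum_mu (is_part_decr pmu) sum_la nz.
have := perm_cell_row sum_mu sum_la e => /cword_part_inj; rewrite !mem_rev.
case/and3P: pmu pla => _ pos_mu _ /and3P[_ pos_la _] /(_ pos_mu pos_la).
by move/(can_inj revK) => e'; rewrite e' eqxx in ne.
Qed.

End Specht.

(** * Homomorphisms from semistandard tableaux, and standard polytabloids *)

Lemma cword_nseq1 n : cword (nseq n 1%N) = iota 0 n.
Proof.
elim: n => // n IH; rewrite -[in RHS]addn1 iotaD add0n -IH.
by rewrite -[LHS]/(cword (nseq n 1%N) ++ nseq 1 (size (nseq n 1%N))) size_nseq.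
Qed.

Section Homs.
Variables (F : fieldType) (n : nat).
Hypothesis char0 : [pchar F] =i pred0.
Implicit Types (la mu nu : seq nat) (s : 'S_n).

Local Notation Mod la := (tabloid_mod n la F).
Local Notation vec la := (@tabloid_vec n la F).
Local Notation rho la := (@trho n la F).
Local Notation t1 mu := (tabloid_of mu (1%g : 'S_n)).
Local Notation sgn s := ((-1) ^+ odd_perm s : F).

(* The orbit sum of [a] under the row group, transported to a map M^mu -> M^la. *)
Definition tab_hom mu la (a : tabloid n la) : 'Hom(Mod mu, Mod la) :=
  tlin (fun t : tabloid n mu => \sum_(U in val t) vec la (tabloid_act U a)).

Lemma tab_hom_rho mu la (a : tabloid n la) s (v : Mod mu) :
  tab_hom mu a (rho mu s v) = rho la s (tab_hom mu a v).
Proof.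
have -> : tab_hom mu a (rho mu s v) = (tab_hom mu a \o rho mu s)%VF v by rewrite comp_lfunE.
have -> : rho la s (tab_hom mu a v) = (rho la s \o tab_hom mu a)%VF v by rewrite comp_lfunE.
move: v; apply/lfunP/eq_tabloid_lfun => t.
rewrite [LHS]comp_lfunE [RHS]comp_lfunE trho_vec [LHS]tlin_vec tlin_vec.
rewrite (linear_sum (rho la s)) /= big_imset /=; last by apply: in2W; apply: mulIg.
by apply: eq_bigr => U _; rewrite trho_vec tabloid_actM.
Qed.

Lemma tab_hom_antisym nu mu la (a : tabloid n la) (v : Mod mu) :
  tab_hom mu a (col_antisym F n nu mu v) = col_antisym F n nu la (tab_hom mu a v).
Proof.
rewrite !col_antisymE (linear_sum (tab_hom mu a)); apply: eq_bigr => s _.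
by rewrite /= linearZ /= tab_hom_rho.
Qed.

Section Coef.
Variables (mu la : seq nat).
Hypotheses (sum_mu : sumn mu = n) (decr_mu : forall r, (nth 0 mu r.+1 <= nth 0 mu r)%N).
Hypothesis (sum_la : sumn la = n).
Implicit Types (a b : tabloid n la).

Lemma tcoef_tab_hom a b : tcoef b (tab_hom mu a (spoly F n mu))
  = \sum_(s | colperm mu s) sgn s * \sum_(U in val (t1 mu)) (b == tabloid_act (U * s)%g a)%:R.
Proof.
rewrite -col_antisym_spoly tab_hom_antisym tlin_vec col_antisymE tcoef_sum.
apply: eq_bigr => s _.
transitivity (sgn s * tcoef b (rho la s (\sum_(U in val (t1 mu)) vec la (tabloid_act U a)))).
  exact: tcoefZ.
congr (_ * _); rewrite (linear_sum (rho la s)) tcoef_sum.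
by apply: eq_bigr => U _; rewrite /= trho_vec tcoef_vec tabloid_actM.
Qed.

Lemma semistandard_tword a : semistandard mu (tword a) ->
  col_strict mu (trow a) /\ row_weak mu (trow a).
Proof.
move=> /(semistandard_strict sum_mu)[st wk]; split=> c d e1 e2.
  by have := st c d e1 e2; rewrite !nth_tword.
by have := wk c d e1 e2; rewrite !nth_tword.
Qed.

(** [trow b] after the column permutation s is [trow a] after the row permutation inverse to U, the
    situation of [tableau_triangular]. *)
Lemma tab_hom_match a b s (U : 'S_n) :
  semistandard mu (tword a) -> semistandard mu (tword b) ->
  colperm mu s -> U \in val (t1 mu) -> b = tabloid_act (U * s)%g a ->
  (weight mu (trow a) < weight mu (trow b))%N \/ (s = 1%g /\ b = a).
Proof.
move=> /semistandard_tword[st_a wk_a] /semistandard_tword[st_b wk_b] cs.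
rewrite (mem_tabloid sum_mu) => /forallP rU eb.
have rU' : rowperm mu U^-1%g.
  by apply/forallP => c; have := rU c; rewrite trow_of // invg1 perm1 eq_sym.
have e c : trow b (s c) = trow a (U^-1%g c).
  by rewrite eb trow_act // invMg permM permK.
have [lt_w|[s1 eab]] := tableau_triangular sum_mu decr_mu st_b wk_b wk_a cs rU' e; first by left.
by right; split=> //; apply: (trow_inj sum_la).
Qed.

Lemma tab_hom_triangular a b :
  semistandard mu (tword a) -> semistandard mu (tword b) ->
  tcoef b (tab_hom mu a (spoly F n mu)) != 0 ->
  (weight mu (trow a) < weight mu (trow b))%N \/ a = b.
Proof.
move=> ss_a ss_b nz; have [lt_w|le_w] := ltnP (weight mu (trow a)) (weight mu (trow b)).
  by left.
have [->|ne_ab] := eqVneq a b; [by right | case/negP: nz].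
rewrite tcoef_tab_hom big1 // => s cs; rewrite big1 ?mulr0 // => U tU.
case: eqP => // /(tab_hom_match ss_a ss_b cs tU)[lt_w|[_ e]]; first by rewrite leqNgt lt_w in le_w.
by rewrite e eqxx in ne_ab.
Qed.

(** Only s = 1 contributes, and what remains is the number of row permutations U fixing a, positive
    because U = 1 is one of them. *)
Lemma tab_hom_diag a : semistandard mu (tword a) ->
  tcoef a (tab_hom mu a (spoly F n mu)) != 0.
Proof.
move=> ss_a; rewrite tcoef_tab_hom (bigD1 1%g (colperm1 n mu)) /= odd_perm1 mul1r.
rewrite [X in _ + X]big1 ?addr0 => [|s /andP[cs ne_s]]; last first.
  rewrite big1 ?mulr0 // => U tU; case: eqP => // /(tab_hom_match ss_a ss_a cs tU).
  by rewrite ltnn => -[//|[e _]]; rewrite e eqxx in ne_s.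
rewrite -natr_sum; have /pcharf0P -> := char0.
have t11 : (1%g : 'S_n) \in val (t1 mu).
  by rewrite mem_tabloid_of row_equivE //; apply/forallP.
by rewrite (bigD1 _ t11) /= mulg1 tabloid_act1 eqxx.
Qed.

End Coef.

Lemma tabloid1_perm (t : tabloid n (nseq n 1%N)) : exists T : 'S_n, forall c, trow t c = T c.
Proof.
have sum1 : sumn (nseq n 1%N) = n by rewrite sumn_nseq mul1n.
have [U ->] := tabloidP t; exists U^-1%g => c; rewrite trow_of //.
have := mkseq_cell_row (nseq n 1%N).
have -> : rev (nseq n 1%N) = nseq n 1%N by rewrite rev_nseq.
rewrite sum1 cword_nseq1 => /(congr1 (nth 0%N ^~ (U^-1%g c))).
by rewrite nth_mkseq // nth_iota.
Qed.

(** A standard tableau is a semistandard one of content 1^n, given by a tabloid of shape 1^n, that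
    is, by a permutation. The polytabloids of these fillings are triangular against their own
    tabloids, hence free. *)
Lemma dim_specht mu : is_part n mu ->
  (#|[pred t : tabloid n (nseq n 1%N) | semistandard mu (tword t)]| <= \dim (specht n mu F))%N.
Proof.
move=> pmu; have sum_mu := is_part_sum pmu; have decr_mu := is_part_decr pmu.
set A := [pred t | _].
pose tT (t : tabloid n (nseq n 1%N)) : 'S_n := odflt 1%g [pick T : 'S_n | [forall c, trow t c == T c :> nat]].
have tTE t c : trow t c = tT t c.
  rewrite /tT; case: pickP => [T /forallP/(_ c)/eqP //|no].
  by have [T eT] := tabloid1_perm t; have /negP[] := negbT (no T); apply/forallP => d; rewrite eT.
pose tb (i : 'I_#|A|) := enum_val i.
have ss i : col_strict mu (trow (tb i)) /\ row_weak mu (trow (tb i)).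
  by apply: semistandard_tword => //; exact: (enum_valP i).
pose X := [tuple polytabloid mu F (tT (tb i)) | i < #|A|].
suff fX : free X.
  have <- : size X = #|A| by rewrite size_tuple.
  rewrite -(eqnP fX); apply/dimvS/span_subvP => _ /mapP[i _ ->].
  by rewrite polytabloidE // spoly_specht.
pose m i j := tcoef (tabloid_of mu (tT (tb j))) (polytabloid mu F (tT (tb i))).
pose wt (i : 'I_#|A|) := weight mu (trow (tb i)).
(* The weight falls where [triangular_indep] wants it to rise, so it is subtracted from its
   maximum. *)
pose w i := (\max_j wt j - wt i)%N.
have le_wt i : (wt i <= \max_j wt j)%N by apply: leq_bigmax.
have mE i j : m i j = \sum_(s | colperm mu s)
    sgn s * (tabloid_of mu (tT (tb j)) == tabloid_of mu (s * tT (tb i))%g)%:R.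
  rewrite /m polytabloidE // tcoef_rho tcoef_spoly; apply: eq_bigr => s _; congr (_ * _%:R).
  congr nat_of_bool; rewrite !tabloid_act_of mul1g; apply/eqP/eqP => e.
    have := congr1 (tabloid_act (tT (tb i))) e; rewrite !tabloid_act_of.
    by rewrite mulgKV.
  have := congr1 (tabloid_act (tT (tb i))^-1%g) e; rewrite !tabloid_act_of.
  by rewrite mulgK.
have match_ij i j s : colperm mu s ->
    tabloid_of mu (tT (tb j)) = tabloid_of mu (s * tT (tb i))%g ->
    (w i < w j)%N \/ (s = 1%g /\ i = j).
  move=> cs e; pose r := (s * tT (tb i) * (tT (tb j))^-1)%g.
  have rr : rowperm mu r.
    apply/forallP => c; have := congr1 (fun t => trow t (tT (tb i) (s c))) e.
    by rewrite !trow_of // /r invMg !permM !permK => <-.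
  have eq_fg c : trow (tb i) (s c) = trow (tb j) (r c).
    by rewrite !tTE /r !permM permKV.
  have [[st_i wk_i] [_ wk_j]] := (ss i, ss j).
  have [lt_w|[s1 eij]] := tableau_triangular sum_mu decr_mu st_i wk_i wk_j cs rr eq_fg.
    by left; have := le_wt i; move: lt_w; rewrite -/(wt i) -/(wt j) /w; lia.
  right; split=> //; apply: enum_val_inj; apply: trow_inj => //.
  by rewrite sumn_nseq mul1n.
apply/freeP => k sum0; have nthX (i : 'I_#|A|) : X`_i = polytabloid mu F (tT (tb i)).
  by rewrite -tnth_nth tnth_mktuple.
suff: forall i, predT i -> k i = 0 by move=> H i; apply: H.
apply: (triangular_indep (m := m) (w := w)) => [j _|i j _ _ nz|i _].
- have := congr1 (tcoef (tabloid_of mu (tT (tb j)))) sum0.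
  rewrite tcoef_sum linear0 => e; rewrite -[RHS]e; apply: eq_bigr => i _.
  by rewrite nthX /m -(tcoefZ _ (k i)).
- have [lt_w|le_w] := ltnP (w i) (w j); [by left|right]; apply/eqP; apply: contraNT nz => ne_ij.
  rewrite mE big1 // => s cs; case: eqP => [/(match_ij _ _ _ cs)|_]; last by rewrite mulr0.
  by move=> [|[_ e]]; [rewrite ltnNge le_w | rewrite e eqxx in ne_ij].
rewrite mE (bigD1 1%g (colperm1 n mu)) /= mul1g eqxx odd_perm1 mul1r.
rewrite big1 ?addr0 ?oner_eq0 // => s /andP[cs ne_s].
case: eqP => [/(match_ij _ _ _ cs)|_]; last by rewrite mulr0.
by rewrite ltnn => -[//|[e _]]; rewrite e eqxx in ne_s.
Qed.

End Homs.

(** * Independence of the images, over a field with conjugation *)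

Section Closed.
Variables (C : numClosedFieldType) (n : nat).
Implicit Types (la mu nu : seq nat) (s : 'S_n).

Local Notation Mod la := (tabloid_mod n la C).
Local Notation vec la := (@tabloid_vec n la C).
Local Notation rho la := (@trho n la C).
Local Notation sgn s := ((-1) ^+ odd_perm s : C).

Let char0 : [pchar C] =i pred0 := @pchar_num C.

Definition tconj mu (v : Mod mu) : Mod mu := [ffun t => (tcoef t v)^*].

Lemma tcoef_conj mu t (v : Mod mu) : tcoef t (tconj v) = (tcoef t v)^*.
Proof. by rewrite /tcoef ffunE. Qed.

(** The spanning polytabloids have integer coordinates. *)
Lemma tconj_specht mu (v : Mod mu) : sumn mu = n ->
  v \in specht n mu C -> tconj v \in specht n mu C.
Proof.
move=> sum_mu; set X := [seq polytabloid mu C T | T <- enum 'S_n].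
move=> /(coord_span (X := in_tuple X)) ->.
set a := coord _; set k := size _.
have -> : tconj (\sum_(i < k) a i v *: (in_tuple X)`_i)
          = \sum_(i < k) (a i v)^* *: (in_tuple X)`_i.
  apply: tcoefP => t; rewrite tcoef_conj !tcoef_sum rmorph_sum; apply: eq_bigr => i _ /=.
  have : (in_tuple X)`_i \in X by apply: mem_nth.
  move=> /mapP[T _ ->]; rewrite (tcoefZ t (a i v)) (tcoefZ t (a i v)^*) rmorphM; congr (_ * _).
  rewrite polytabloidE // tcoef_rho // tcoef_spoly rmorph_sum; apply: eq_bigr => s _.
  by rewrite rmorphM /= rmorph_sign rmorph_nat.
apply: memv_suml => i _; apply/memvZ/memv_span; exact: mem_nth.
Qed.

(** The hypothesis makes x orthogonal to all of S^mu, in particular to its own conjugate, so the sum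
    of the squared moduli of its coordinates is 0. *)
Lemma specht_nondegenerate mu (x : Mod mu) : is_part n mu -> x \in specht n mu C ->
  (forall s, tdot (spoly C n mu) (rho mu s x) = 0) -> x = 0.
Proof.
move=> pmu; have sum_mu := is_part_sum pmu => xS orth.
pose f : 'Hom(Mod mu, C^o) := linfun (tdot x : Mod mu -> C^o).
have fE w : f w = tdot x w by rewrite lfunE.
have /subvP/(_ _ (tconj_specht sum_mu xS)) : (specht n mu C <= lker f)%VS.
  apply: specht_ind => // s; rewrite memv_ker fE tdotC.
  by have := orth s^-1%g; rewrite tdot_rho invgK => ->.
rewrite memv_ker fE => /eqP sum0; apply: tcoefP => t; rewrite linear0.
have sq_ge0 u : true -> 0 <= tcoef u (tconj x) * tcoef u x.
  by rewrite tcoef_conj mulrC mul_conjC_ge0.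
have /(_ t isT) := psumr_eq0P sq_ge0 sum0.
by rewrite tcoef_conj mulrC => /eqP; rewrite mul_conjC_eq0 => /eqP.
Qed.

Section Independence.
Variables (la : seq nat) (I : finType) (mu : I -> seq nat) (a : I -> tabloid n la).
Hypotheses (sum_la : sumn la = n) (part_mu : forall i, is_part n (mu i)).
Hypothesis ss_a : forall i, semistandard (mu i) (tword (a i)).
Hypothesis inj_a : forall i j, mu i = mu j -> a i = a j -> i = j.

(** Let i0 have the largest [row_sum] among the nonzero x i. Antisymmetrizing any translate of the
    relation over the columns of mu i0 leaves a triangular system in the pairings of [spoly] with
    that translate; their vanishing for all s contradicts nondegeneracy. *)
Lemma tab_hom_indep (x : forall i, Mod (mu i)) :
  (forall i, x i \in specht n (mu i) C) ->
  \sum_i tab_hom C (mu i) (a i) (x i) = 0 -> forall i, x i = 0.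
Proof.
move=> xS sum0 i; apply/eqP; apply: contraT => nz_i.
case: (@arg_maxnP _ i (fun j => x j != 0) (fun j => row_sum n (mu j)) nz_i) => i0 nz0 max0.
case/eqP: (nz0); apply: specht_nondegenerate => // s.
pose c j := tdot (spoly C n (mu j)) (rho (mu j) s (x j)).
pose P j := (mu j == mu i0) && (x j != 0).
suff c0 : forall j, P j -> c j = 0 by apply: (c0 i0); rewrite /P eqxx.
pose h j := tab_hom C (mu j) (a j) (spoly C n (mu j)).
(* A different shape with x j nonzero has no larger [row_sum], so it is killed; an equal shape is
   reduced to the line of [spoly]. *)
have term j : col_antisym C n (mu i0) la (rho la s (tab_hom C (mu j) (a j) (x j)))
              = if P j then c j *: h j else 0.
  rewrite -tab_hom_rho -tab_hom_antisym /P; have [e|ne] := eqVneq (mu j) (mu i0) => /=.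
    rewrite -e (col_antisym_spolyE char0 (is_part_sum (part_mu j)) (is_part_decr (part_mu j))).
    rewrite linearZ /= -/(c j) -/(h j); case: eqP => //= xj0.
    by rewrite /c xj0 !linear0 scale0r.
  have [-> |nzj] := eqVneq (x j) 0; first by rewrite !linear0.
  by rewrite (col_antisym_eq0 char0) ?linear0 // 1?eq_sym //; apply: max0.
apply: (triangular_indep (m := fun j k => tcoef (a k) (h j))
                         (w := fun j => weight (mu j) (trow (a j)))).
- move=> k _.
  have := congr1 (fun v => tcoef (a k) (col_antisym C n (mu i0) la (rho la s v))) sum0.
  rewrite !linear0 (linear_sum (rho la s)) (linear_sum (col_antisym C n (mu i0) la)) tcoef_sum.
  move=> e; rewrite -[RHS]e big_mkcond; apply: eq_bigr => j _; rewrite /= term.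
  by case: ifP => _; rewrite ?linear0 // (tcoefZ (a k) (c j)).
- move=> j k /andP[/eqP ej _] /andP[/eqP ek _] nz.
  have ejk : mu j = mu k by rewrite ej ek.
  have ss_k : semistandard (mu j) (tword (a k)) by rewrite ejk.
  have sum_j := is_part_sum (part_mu j); have decr_j := is_part_decr (part_mu j).
  have [lt_w|e] := tab_hom_triangular sum_j decr_j sum_la (ss_a j) ss_k nz.
    by left; rewrite -ejk.
  by right; apply: inj_a.
move=> j _; have sum_j := is_part_sum (part_mu j); have decr_j := is_part_decr (part_mu j).
exact: (tab_hom_diag char0 sum_j decr_j sum_la (ss_a j)).
Qed.

End Independence.

End Closed.

(** * Decomposition of M^la into Specht modules *)

Section Young.
Variables (C : numClosedFieldType) (n : nat) (la : seq nat).
Hypothesis part_la : is_part n la.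

Local Notation bpart := {ffun 'I_n.+1 -> 'I_n.+1}.
Local Notation Mod la := (tabloid_mod n la C).

Let sum_la : sumn la = n := is_part_sum part_la.

(** One index for each copy of a Specht module: the second component is a semistandard tableau of
    content la, encoded as a tabloid, so a shape rho occurs K_(rho, la) times. *)
Definition kostka_pairs := [pred x : bpart * tabloid n la |
  (decreasing x.1 && (psize x.1 == n)) && semistandard (trim x.1) (tword x.2)].

Local Notation k := #|kostka_pairs|.
Let shape_of (j : 'I_k) : seq nat := trim (enum_val j).1.
Let tab_of (j : 'I_k) : tabloid n la := (enum_val j).2.

Let shape_part j : is_part n (shape_of j).
Proof.
have := enum_valP j; rewrite inE => /andP[/andP[dr /eqP sz] _].
by have := is_part_trim dr; rewrite sz.
Qed.

Let tab_ss j : semistandard (shape_of j) (tword (tab_of j)).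
Proof. by have := enum_valP j; rewrite inE => /andP[]. Qed.

Let tab_inj i j : shape_of i = shape_of j -> tab_of i = tab_of j -> i = j.
Proof.
move=> es et; apply: enum_val_inj.
have := enum_valP i; rewrite inE => /andP[/andP[di _] _].
have := enum_valP j; rewrite inE => /andP[/andP[dj _] _].
rewrite [LHS]surjective_pairing [RHS]surjective_pairing -/(tab_of i) -/(tab_of j) et.
congr (_, _); apply: eq_bpart => r _.
by rewrite -(nth_trim r di) -(nth_trim r dj) -/(shape_of i) es.
Qed.

Lemma sum_kostka_pairs (g : bpart -> nat) :
  (\sum_(j < k) g (enum_val j).1 = \sum_(rho : bpart | decreasing rho && (psize rho == n))
     count (semistandard (trim rho)) (permutations (cword (rev la))) * g rho)%N.
Proof.
rewrite -(big_enum_val (A := kostka_pairs) (fun x => g x.1)) /=.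
rewrite -(pair_big_dep (fun rho : bpart => decreasing rho && (psize rho == n))
  (fun rho (t : tabloid n la) => semistandard (trim rho) (tword t)) (fun rho _ => g rho)) /=.
apply: eq_bigr => rho _; by rewrite (count_tword sum_la) sum_nat_const.
Qed.

Lemma sum_nchain_kostka al : (\sum_(j < k) nchain al (enum_val j).1 = ntable la al)%N.
Proof. by rewrite sum_kostka_pairs -(ntable_count_semistandard _ sum_la). Qed.

Let hom (j : 'I_k) := tab_hom C (shape_of j) (tab_of j).
Let U (j : 'I_k) : {vspace Mod la} := (hom j @: specht n (shape_of j) C)%VS.

Let hom_inj j : {in specht n (shape_of j) C &, injective (hom j)}.
Proof.
move=> x y xS yS exy; apply/eqP; rewrite -subr_eq0; apply/eqP.
(* Injectivity of one map is independence of a one-element family. *)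
apply: (@tab_hom_indep C n la unit (fun _ => shape_of j) (fun _ => tab_of j)
  sum_la _ _ _ (fun _ => x - y) _ _ tt) => [||[] []//|_|].
- by move=> _; exact: shape_part.
- by move=> _; exact: tab_ss.
- exact: memvB.
- by rewrite big_const card_unit /= addr0 linearB /= -/(hom j) exy subrr.
Qed.

Let direct_U : directv (\sum_j U j).
Proof.
apply/directv_sum_independent => us usU sum0 j _.
have ex i : exists x, (x \in specht n (shape_of i) C) && (hom i x == us i).
  by have /memv_imgP[x xS ->] := usU i isT; exists x; rewrite xS eqxx.
pose x i := xchoose (ex i).
have xP i : x i \in specht n (shape_of i) C /\ hom i (x i) = us i.
  by have /andP[? /eqP] := xchooseP (ex i).
have <- : hom j (x j) = us j by have [] := xP j.
rewrite (@tab_hom_indep C n la _ shape_of tab_of sum_la shape_part tab_ss tab_inj x).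
- by rewrite linear0.
- by move=> i; have [] := xP i.
rewrite -[RHS]sum0; apply: eq_bigr => i _; by have [] := xP i.
Qed.

Let dim_U j : \dim (U j) = \dim (specht n (shape_of j) C).
Proof.
apply: limg_dim_eq; apply/eqP; rewrite -subv0; apply/subvP => v.
rewrite memv_cap memv_ker memv0 => /andP[vS /eqP v0]; apply/eqP.
by apply: (@hom_inj j); rewrite ?mem0v // v0 linear0.
Qed.

Let sum_U : (\sum_j U j)%VS = fullv.
Proof.
apply/eqP; rewrite eqEdim subvf /= (directvP direct_U) /= dim_tabloid_mod.
have sum1 : sumn (nseq n 1%N) = n by rewrite sumn_nseq mul1n.
(* For content 1^n every block is a single letter, so [card_weak_tabloids] counts all tabloids. *)
have -> : #|{: tabloid n la}| = ntable la (nseq n 1%N).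
  rewrite -(card_weak_tabloids sum_la sum1); apply/esym/eq_card => t; rewrite !inE.
  have szt : size (tword t) = sumn (rev (nseq n 1%N)) by rewrite size_tword sumn_rev.
  suff -> : blocks_sorted (rev (nseq n 1%N)) (tword t) by [].
  apply/(blocks_sortedP szt) => i; rewrite size_tword => lt_i.
  have := mkseq_cell_row (nseq n 1%N); rewrite rev_nseq sum1 cword_nseq1 => e.
  have := congr1 (nth 0%N ^~ i) e; have := congr1 (nth 0%N ^~ i.+1) e.
  rewrite /= !nth_mkseq ?nth_iota // ?(ltnW lt_i) // => -> ->; lia.
rewrite -sum_nchain_kostka; apply: leq_sum => j _; rewrite dim_U.
apply: leq_trans (dim_specht C (shape_part j)).
rewrite -(count_tword sum1) rev_nseq -count_semistandard.
  have := enum_valP j; rewrite inE => /andP[/andP[dr _] _].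
  by apply/eq_leq/eq_count => w; rewrite semistandard_trim.
by have := enum_valP j; rewrite inE => /andP[/andP[dr _] _].
Qed.

Theorem young_rule : Fchar_is (@tabloid_rho n la C) (complete_sym_part la).
Proof.
exists k, shape_of, U; split=> //.
  move=> j; exists (hom j); split=> // s v _.
  have := tab_hom_rho (tab_of j) s v; rewrite trho.unlock; exact.
move=> m; have [al ->] := cmsetP m; rewrite complete_sym_partE -sum_nchain_kostka natr_sum.
apply: eq_bigr => j _; rewrite /shape_of schur_trim //.
by have := enum_valP j; rewrite inE => /andP[/andP[dr _] _].
Qed.

End Young.

Theorem theorem1 (R : realType) (n : nat) (la : seq nat) (hla : is_part n la) :
  (exists p : 'I_n.-1 -> 'End(tabloid_mod n la R[i]),
     hecke0_module p /\ FQchar_is p (complete_sym_part la)) /\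
  Fchar_is (@tabloid_rho n la R[i]) (complete_sym_part la).
Proof.
split; last exact: young_rule.
have sum_la := is_part_sum hla.
exists (@hecke_op R[i] n la); split; first exact: hecke_op_module.
exact: hecke_op_FQchar.
Qed.
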